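(* Let $\alpha\in(0,2)$ and let $X=\{X(t)\}_{t\in[0,1]}$ be a symmetric $\alpha$-stable process of the form $$X(t)=\int_S f(t,s)\,M(ds)\quad\text{a.s. for each }t\in[0,1],$$ where $M$ is an independently scattered symmetric $\alpha$-stable random measure on a measurable space $(S,\mathcal S)$ with finite control measure $m$ and $f(t,\cdot)\in L^\alpha(S,m)$ for all $t\in[0,1]$. Let $\{V_j\}$, $\{\Gamma_j\}$, $\{\varepsilon_j\}$ be the sequences of its LePage representation, so that for each $t\in[0,1]$, $X(t)=c_\alpha m(S)^{1/\alpha}\sum_{j=1}^\infty\varepsilon_j\Gamma_j^{-1/\alpha}f(t,V_j)$ a.s. Assume that $X$ is c\`adl\`ag and continuous in probability and also that $f(\cdot,s)\in D[0,1]$ for all $s$. Then with probability $1$, $$X(t)=c_\alpha m(S)^{1/\alpha}\sum_{j=1}^\infty\varepsilon_j\Gamma_j^{-1/\alpha}f(t,V_j)\qquad\text{for all }t\in[0,1],$$ where the series converges a.s. uniformly on $[0,1]$. Therefore, with probability $1$ $$\Delta X(t)=c_\alpha m(S)^{1/\alpha}\sum_{j=1}^\infty\varepsilon_j\Gamma_j^{-1/\alpha}\Delta f(t,V_j),\qquad t\in[0,1],$$ where the series has no more than one nonzero term for each $t$. That is, $$\mathbb P\bigl(\Delta f(t,V_j)\,\Delta f(t,V_k)=0\ \text{ for all } j\ne k\text{ and }t\in[0,1]\bigr)=1.$$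
   Context: All processes here are real-valued. $D[0,1]$ is the space of real c\`adl\`ag functions on $[0,1]$; $\Delta x(t)=x(t)-x(t-)$ is the jump of $x$ at $t$ (with $\Delta x(0)=0$), and $\Delta f(t,s)$ is the jump at $t$ of $f(\cdot,s)$. $M$ is a random measure, independent on disjoint sets, with $\mathbb E\exp\{i\theta M(A)\}=\exp\{-|\theta|^\alpha m(A)\}$ for all $A\in\mathcal S$, $\theta\in\mathbb R$. $\{V_j\}$ is an i.i.d. sequence of random elements in $S$ with common distribution $m/m(S)$; $\{\Gamma_j\}$ is a sequence of partial sums of i.i.d. standard exponential random variables; $\{\varepsilon_j\}$ is an i.i.d. sequence of symmetric Bernoulli random variables ($\mathbb P(\varepsilon_j=\pm1)=1/2$); these three sequences are independent of each other, and are defined on the same probability space as $X$ in such a way that the stated LePage representation holds a.s. for each $t$. The constant is $c_\alpha=[-\alpha\cos(\pi\alpha/2)\Gamma(-\alpha)]^{-1/\alpha}$ for $\alpha\ne1$ (with $\Gamma(\cdot)$ the gamma function) and $c_1=2/\pi$. *)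

(* Defs.v *)
From HB Require Import structures.
From mathcomp Require Import all_boot all_order all_algebra finmap.
From mathcomp Require Import all_classical all_reals all_analysis.
From mathcomp.real_closed Require Import complex.
Import Order.TTheory GRing.Theory Num.Theory.
Import numFieldNormedType.Exports.
Import HBSimple.

Set Implicit Arguments.
Unset Strict Implicit.
Unset Printing Implicit Defensive.

Local Open Scope classical_set_scope.
Local Open Scope ring_scope.

Section cadlag.
Context {R : realType}.

(* Only the values of x on [0, 1] matter: the two punctured one-sided
   neighbourhoods are taken at points from which they reach into [0, 1]. *)
Definition cadlag01 (x : R -> R) : Prop :=
  (forall t : R, 0 <= t < 1 -> x u @[u --> t^'+] --> x t) /\
  (forall t : R, 0 < t <= 1 -> cvg (x u @[u --> t^'-])).

Definition jump (x : R -> R) (t : R) : R :=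
  if t == 0 then 0 else x t - lim (x u @[u --> t^'-]).

End cadlag.

Section constants.
Context {R : realType}.

Definition euler_integral (x : R) : R :=
  \int[@lebesgue_measure R]_(u in `]0, +oo[) (u `^ (x - 1) * expR (- u)).

(* Gamma(x) = Gamma(x + n) / (x (x + 1) ... (x + n - 1)), where n is chosen
   with 0 < x + n; this is the meromorphic extension of Euler's integral to
   negative arguments (with the junk value 0 at the poles). *)
Definition Gamma (x : R) : R :=
  let n := (Num.truncn `|x|).+1 in
  euler_integral (x + n%:R) / \prod_(i < n) (x + i%:R).

Definition c_ (alpha : R) : R :=
  if alpha == 1 then 2 / pi
  else (- alpha * cos (pi * alpha / 2) * Gamma (- alpha)) `^ (- alpha^-1).

End constants.

Section probability_notions.
Context {d} {T : measurableType d} {R : realType} (P : probability T R).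

Definition char_fun (Y : T -> R) (theta : R) : R[i] :=
  (fine 'E_P[fun w => cos (theta * Y w)] +i*
   fine 'E_P[fun w => sin (theta * Y w)])%C.

(* Mutual independence: product rule over all finite subfamilies. *)
Definition independent (I : choiceType) (F : I -> set_system T) : Prop :=
  forall (J : {fset I}) (A : I -> set T),
    (forall i, i \in J -> F i (A i)) ->
    P (\bigcap_(i in [set` J]) A i) = (\prod_(i <- J) P (A i))%E.

Definition sigma_of {d'} {T' : measurableType d'} (Y : T -> T') :
    set_system T :=
  preimage_set_system setT Y measurable.

Definition sigma_of_seq {d'} {T' : measurableType d'} (Y : nat -> T -> T') :
    set_system T :=
  <<s \bigcup_j sigma_of (Y j) >>.

(* Each of F, G, H will contain the whole space, so that the product rule for
   two of the three classes is included. *)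
Definition independent3 (F G H : set_system T) : Prop :=
  forall A B C, F A -> G B -> H C ->
    P (A `&` B `&` C) = (P A * P B * P C)%E.

Definition cvg_in_prob (I : Type) (F : set_system I)
    (Y : I -> T -> R) (Z : T -> R) : Prop :=
  forall e : R, 0 < e ->
    P [set w | e < `|Y i w - Z w|] @[i --> F] --> 0%E.

Definition continuous_in_prob01 (X : R -> T -> R) : Prop :=
  forall t : R, 0 <= t <= 1 -> cvg_in_prob (within `[0, 1] (nbhs t)) X (X t).

Definition sas_rv (alpha : R) (Y : T -> R) : Prop :=
  exists2 sigma : R, 0 <= sigma &
    forall theta, char_fun Y theta = (expR (- (sigma * `|theta| `^ alpha)))%:C%C.

Definition sas_process01 (alpha : R) (X : R -> T -> R) : Prop :=
  forall (n : nat) (t a : 'I_n -> R), (forall i, 0 <= t i <= 1) ->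
    sas_rv alpha (fun w => \sum_(i < n) a i * X (t i) w).

End probability_notions.

Section stable_integral.
Context {d d'} {T : measurableType d} {S : measurableType d'} {R : realType}.
Context (P : probability T R) (m : {finite_measure set S -> \bar R}).

Record sas_random_measure (alpha : R) (M : set S -> {RV P >-> R}) : Prop := {
  sasrm_char_fun : forall A, measurable A -> forall theta : R,
    char_fun P (M A) theta =
    (expR (- (`|theta| `^ alpha * fine (m A))))%:C%C ;
  sasrm_indep : forall A : nat -> set S, (forall n, measurable (A n)) ->
    trivIset setT A -> independent P (fun n => sigma_of (M (A n))) ;
  sasrm_additive : forall A : nat -> set S, (forall n, measurable (A n)) ->
    trivIset setT A ->
    {ae P, forall w,
      \sum_(i < n) M (A i) w @[n --> \oo] --> M (\bigcup_n A n) w} }.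

Definition simple_stable_integral (M : set S -> {RV P >-> R})
    (g : {sfun S >-> R}) (w : T) : R :=
  \sum_(x \in range g) x * M (g @^-1` [set x]) w.

(* Y is a version of \int h dM, the extension of the integral of simple
   functions from L^alpha(m) to convergence in probability. *)
Definition is_stable_integral (alpha : R) (M : set S -> {RV P >-> R})
    (h : S -> R) (Y : T -> R) : Prop :=
  exists2 g : nat -> {sfun S >-> R},
    (\int[m]_s (`|g n s - h s| `^ alpha)%:E)%E @[n --> \oo] --> 0%E &
    cvg_in_prob P \oo (fun n => simple_stable_integral M (g n)) Y.

End stable_integral.

Section lepage.
Context {d d'} {T : measurableType d} {S : measurableType d'} {R : realType}.
Context (P : probability T R) (m : {finite_measure set S -> \bar R}).

(* Sequences are indexed from 0: arrival tau j is Gamma_(j+1). *)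
Definition arrival (tau : nat -> T -> R) (j : nat) (w : T) : R :=
  \sum_(i < j.+1) tau i w.

(* The law of V j is m / m(S); taking B = setT, this forces 0 < m(S). *)
Record lepage_sequences (V : nat -> {RV P >-> S})
    (tau eps : nat -> {RV P >-> R}) : Prop := {
  lepage_V_law : forall j B, measurable B ->
    P (V j @^-1` B) = (fine (m B) / fine (m setT))%:E ;
  lepage_V_indep : independent P (fun j => sigma_of (V j)) ;
  lepage_tau_law : forall j B, measurable B ->
    P (tau j @^-1` B) = exponential_prob (1 : R) B ;
  lepage_tau_indep : independent P (fun j => sigma_of (tau j)) ;
  lepage_eps_law : forall j,
    P (eps j @^-1` [set 1]) = (2^-1)%:E /\
    P (eps j @^-1` [set -1]) = (2^-1)%:E ;
  lepage_eps_indep : independent P (fun j => sigma_of (eps j)) ;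
  lepage_indep : independent3 P (sigma_of_seq V)
    (sigma_of_seq (arrival tau)) (sigma_of_seq eps) }.

Definition lepage_term (alpha : R) (V : nat -> T -> S)
    (tau eps : nat -> T -> R) (g : S -> R) (w : T) (j : nat) : R :=
  eps j w * arrival tau j w `^ (- alpha^-1) * g (V j w).

Definition lepage_sum (alpha : R) (V : nat -> T -> S)
    (tau eps : nat -> T -> R) (g : S -> R) (w : T) (n : nat) : R :=
  c_ alpha * fine (m setT) `^ alpha^-1 *
  \sum_(j < n) lepage_term alpha V tau eps g w j.

End lepage.

(* Main.v *)
(* Conditionally on the arrival times and the V_j, the LePage series is a
   Rademacher series of cadlag functions, converging at the rationals to a
   function with one-sided limits.  Near each t, on either side, the limit
   oscillates little with probability more than 1/2; by Levy's inequality so do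
   all the partial sums with positive probability, and by the zero-one law the
   partial sums are then almost surely Cauchy up to a small error on a whole
   neighbourhood of t.  Compactness of [0, 1] gives uniform convergence, under
   which jumps pass to the limit.  Since X has no fixed jumps, flipping one sign
   shows that neither has f(., V_j), and two independent functions with
   countably many jumps and no fixed ones a.s. never jump together. *)
From HB Require Import structures.
Require Import Defs.
From mathcomp Require Import all_boot all_order all_algebra finmap.
From mathcomp Require Import all_classical all_reals all_analysis measurable_realfun.
From mathcomp Require Import ring lra.
Import Order.TTheory GRing.Theory Num.Theory.
Import numFieldNormedType.Exports.
Set Implicit Arguments.
Unset Strict Implicit.
Unset Printing Implicit Defensive.
Local Open Scope classical_set_scope.
Local Open Scope ring_scope.

(** Conditioning is Fubini's theorem on shocks times coins, so every property handed to it must be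
    an event of that product, whereas [X] is not given as a function of shocks and signs. Its path
    regularity is therefore replaced by [regular_limit], a property of the partial sums at rational
    points (convergence, and a bound on the number of disjoint intervals of large oscillation) that
    uses countable quantifiers only. The uniform Cauchy property and the absence of common jumps are
    put in the same form. The bound 1/2 is dictated by the factor 2 in Levy's inequality: an
    eventual excess of probability below 1/2 keeps an excess at any time below probability 1.
    Increments are taken strictly on one side of t because the limit may jump at t; the existence of
    one-sided limits makes the excess events decrease to a null set as the neighbourhood shrinks.
    Flipping a sign shows that a jump vanishes only after division by the normalising constant and
    by the weights of the arrival times. Hence the proof that [c_ alpha] is nonzero, which for alpha
    other than 1 rests on Euler's integral being finite and positive on ]0, 1[. *)

(** * Compactness of [0, 1] and finite partitions for cadlag functions *)

Section cadlag_paths.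
Context {R : realType}.
Implicit Types (x y : R -> R) (t : R).

(** Compactness as induction over intervals: the supremum of the right ends reached from 0 is itself
    reached, and the local hypothesis pushes past it unless it is 1. It serves for partitions, for
    common jumps and for the uniform Cauchy property. *)
Lemma cousin (Q : R -> R -> Prop) :
  (forall a b c, 0 <= a -> a <= b -> b <= c -> c <= 1 ->
    Q a b -> Q b c -> Q a c) ->
  (forall t, 0 <= t <= 1 -> exists2 d, 0 < d & forall a b,
    0 <= a -> t - d < a -> a <= t -> t <= b -> b < t + d -> b <= 1 -> Q a b) ->
  Q 0 1.
Proof.
move=> Qtrans Qloc; pose A := [set c : R | 0 <= c <= 1 /\ Q 0 c].
have A0 : A 0.
  split; first lra.
  have [d d0 Hd] : exists2 d, 0 < d & forall a b, 0 <= a -> 0 - d < a ->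
    a <= 0 -> 0 <= b -> b < 0 + d -> b <= 1 -> Q a b by apply: Qloc; lra.
  by apply: Hd; lra.
have supA : has_sup A.
  by split; [exists 0 | exists 1 => c [/andP[]]].
have s01 : 0 <= sup A <= 1.
  apply/andP; split; first exact: (ub_le_sup supA.2 A0).
  by apply: ge_sup; [exists 0 | move=> c [/andP[]]].
have [d d0 Hd] := Qloc _ s01.
have [c [c01 Qc] sc] := sup_adherent d0 supA.
have cs : c <= sup A by apply: (ub_le_sup supA.2).
(* Half a local radius past the supremum, capped at 1; since [b] turns out to lie in [A], the cap
   must be active. *)
pose b := Num.min 1 (sup A + d / 2).
have sb : sup A <= b by rewrite /b le_min; apply/andP; split; lra.
have b1 : b <= 1 by rewrite /b ge_min lexx.
have bd : b < sup A + d by rewrite /b gt_min; apply/orP; right; lra.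
have Qb : Q 0 b.
  apply: (Qtrans _ c) => //; try lra.
  by apply: Hd => //; lra.
have bs : b <= sup A by apply: (ub_le_sup supA.2); split => //; lra.
suff <- : b = 1 by [].
have : b = 1 \/ b = sup A + d / 2.
  by rewrite /b /Num.min; case: ifP => _; [left|right].
by case=> // bE; lra.
Qed.

Lemma cadlag_right x t e : cadlag01 x -> 0 <= t < 1 -> 0 < e ->
  exists2 d, 0 < d & forall u, t <= u -> u < t + d -> `|x u - x t| < e.
Proof.
move=> [xr _] t01 e0; have /cvgrPdist_lt/(_ _ e0) := xr _ t01.
case/nbhs_ballP => d /= d0 Hd; exists d => // u tu ud.
have [->|ut] := eqVneq u t; first by rewrite subrr normr0.
rewrite distrC; apply: Hd; last by rewrite lt_neqAle eq_sym ut.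
rewrite /ball /= ltr_norml; apply/andP; split; lra.
Qed.

Lemma cadlag_left x t e : cadlag01 x -> 0 < t <= 1 -> 0 < e ->
  exists2 d, 0 < d & forall u, t - d < u -> u < t ->
    `|x u - lim (x v @[v --> t^'-])| < e.
Proof.
move=> [_ xl] t01 e0; have /cvgrPdist_lt/(_ _ e0) := xl _ t01.
case/nbhs_ballP => d /= d0 Hd; exists d => // u tu ud.
rewrite distrC; apply: Hd => //.
rewrite /ball /= ltr_norml; apply/andP; split; lra.
Qed.

(** Near a point t the single cut t suffices, both sides being within e/2 of a one-sided limit;
    gluing adds the division point to the cuts. The cut condition is half-open because right
    continuity makes p = t harmless. *)
Lemma cadlag_partition x e : cadlag01 x -> 0 < e ->
  exists ts : seq R, forall p q, 0 <= p -> p < q -> q <= 1 ->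
    (forall t, t \in ts -> ~ (p < t <= q)) -> `|x p - x q| < e.
Proof.
move=> cx e0; have e20 : 0 < e / 2 by lra.
pose Q a b := exists ts : seq R, forall p q, a <= p -> p < q -> q <= b ->
  (forall t, t \in ts -> ~ (p < t <= q)) -> `|x p - x q| < e.
apply: (@cousin Q).
- move=> a b c a0 ab bc c1 [ts1 H1] [ts2 H2]; exists (b :: ts1 ++ ts2).
  move=> p q ap pq qc H.
  have Hb : ~ (p < b <= q) by apply: H; rewrite inE eqxx.
  have [qb|bq] := leP q b.
    by apply: H1 => // t tts; apply: H; rewrite inE mem_cat tts orbT.
  apply: H2 => //; first by rewrite leNgt; apply/negP => pb; apply: Hb; lra.
  by move=> t tts; apply: H; rewrite inE mem_cat tts !orbT.
- move=> t t01.
  have [d1 d10 H1] : exists2 d, 0 < d & forall u, u <= 1 -> t <= u ->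
      u < t + d -> `|x u - x t| < e / 2.
    have [t1|t1] := ltP t 1.
      have [|d d0 Hd] := @cadlag_right _ t _ cx _ e20; first lra.
      by exists d => // u _; exact: Hd.
    exists 1 => // u u1 tu _; have -> : u = t by lra.
    by rewrite subrr normr0.
  have [d2 d20 H2] : exists2 d, 0 < d & exists l, forall u, 0 <= u ->
      t - d < u -> u < t -> `|x u - l| < e / 2.
    have [t0|t0] := ltP 0 t.
      have [|d d0 Hd] := @cadlag_left _ t _ cx _ e20; first lra.
      by exists d => //; exists (lim (x v @[v --> t^'-])) => u _; exact: Hd.
    by exists 1 => //; exists 0 => u u0 _ ut; exfalso; lra.
  case: H2 => l H2.
  exists (Num.min d1 d2); first by rewrite lt_min d10.
  move=> a b a0 ta at_ tb btd b1; exists [:: t] => p q ap pq qb H.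
  have {}H : ~ (p < t <= q) by apply: H; rewrite inE.
  have m1 : Num.min d1 d2 <= d1 by rewrite ge_min lexx.
  have m2 : Num.min d1 d2 <= d2 by rewrite ge_min lexx orbT.
  have [qt|tq] := ltP q t.
    have -> : x p - x q = (x p - l) - (x q - l) by ring.
    rewrite (le_lt_trans (ler_normB _ _))// (splitr e) ltrD// H2//; lra.
  have tp : t <= p by rewrite leNgt; apply/negP => pb; apply: H; lra.
  have -> : x p - x q = (x p - x t) - (x q - x t) by ring.
  rewrite (le_lt_trans (ler_normB _ _))// (splitr e) ltrD// H1//; lra.
Qed.

End cadlag_paths.

(** * Jumps of cadlag functions seen through rational increments *)

Section cadlag_jumps.
Context {R : realType}.
Implicit Types (x y : R -> R) (t : R).

Lemma invrS_lt (e : R) : 0 < e -> exists n : nat, n.+1%:R^-1 < e.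
Proof. by move=> /ltr_add_invr[n]; rewrite add0r; exists n. Qed.

Lemma jump_detect x t e : cadlag01 x -> 0 < t <= 1 -> e < `|jump x t| ->
  exists2 d, 0 < d & forall p q, t - d < p -> p < t -> t <= q -> q < t + d ->
    q <= 1 -> e < `|x p - x q|.
Proof.
move=> cx t01 ej; set l := lim (x u @[u --> t^'-]).
have jE : jump x t = x t - l by rewrite /jump gt_eqF //; case/andP: t01.
(* Half of the slack: one error [r] is spent on the left limit, the other on right continuity. *)
pose r := (`|jump x t| - e) / 2; have r0 : 0 < r by rewrite /r; lra.
have [d1 d10 H1] := cadlag_left cx t01 r0.
have [d2 d20 H2] : exists2 d, 0 < d & forall u, t <= u -> u < t + d ->
    u <= 1 -> `|x u - x t| < r.
  have [t1|t1] := ltP t 1.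
    have [|d d0 Hd] := @cadlag_right _ x t r cx _ r0; first lra.
    by exists d => // u tu ud _; exact: Hd.
  exists 1 => // u tu _ u1; have -> : u = t by lra.
  by rewrite subrr normr0.
exists (Num.min d1 d2); first by rewrite lt_min d10.
move=> p q tp pt tq qt q1.
have m1 : Num.min d1 d2 <= d1 by rewrite ge_min lexx.
have m2 : Num.min d1 d2 <= d2 by rewrite ge_min lexx orbT.
have {H1}Hp : `|x p - l| < r by apply: H1; lra.
have {H2}Hq : `|x q - x t| < r by apply: H2; lra.
have E : jump x t = (x p - l) - (x p - x q) - (x q - x t) by rewrite jE; ring.
have := ler_normB ((x p - l) - (x p - x q)) (x q - x t); rewrite -E.
have := ler_normB (x p - l) (x p - x q).
by rewrite /r in Hp Hq *; lra.
Qed.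

Lemma jump0_continuous x t e : cadlag01 x -> 0 <= t <= 1 -> jump x t = 0 ->
  0 < e -> exists2 d, 0 < d & forall u, 0 <= u -> u <= 1 -> t - d < u ->
    u < t + d -> `|x u - x t| < e.
Proof.
move=> cx t01 j0 e0.
have [d2 d20 H2] : exists2 d, 0 < d & forall u, t <= u -> u < t + d ->
    u <= 1 -> `|x u - x t| < e.
  have [t1|t1] := ltP t 1.
    have [|d d0 Hd] := @cadlag_right _ x t e cx _ e0; first lra.
    by exists d => // u tu ud _; exact: Hd.
  exists 1 => // u tu _ u1; have -> : u = t by lra.
  by rewrite subrr normr0.
have [d1 d10 H1] : exists2 d, 0 < d & forall u, 0 <= u -> t - d < u ->
    u < t -> `|x u - x t| < e.
  have [t0|t0] := ltP 0 t; last by exists 1 => // u *; exfalso; lra.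
  have [|d d0 Hd] := @cadlag_left _ x t e cx _ e0; first lra.
  exists d => // u _ tu ut; have := Hd _ tu ut.
  by move: j0; rewrite /jump gt_eqF// => /eqP; rewrite subr_eq0 => /eqP <-.
exists (Num.min d1 d2); first by rewrite lt_min d10.
move=> u u0 u1 tu ut.
have m1 : Num.min d1 d2 <= d1 by rewrite ge_min lexx.
have m2 : Num.min d1 d2 <= d2 by rewrite ge_min lexx orbT.
have [ut'|tu'] := ltP u t; first by apply: H1 => //; lra.
by apply: H2 => //; lra.
Qed.

Lemma seq_gap (ts : seq R) t : exists2 d, 0 < d &
  forall s, s \in ts -> s != t -> d <= `|s - t|.
Proof.
elim: ts => [|s ts [d d0 Hd]]; first by exists 1.
have [->|st] := eqVneq s t.
  exists d => // s'; rewrite inE => /orP[/eqP ->|]; last exact: Hd.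
  by rewrite eqxx.
exists (Num.min d `|s - t|).
  by rewrite lt_min d0 normr_gt0 subr_eq0.
move=> s'; rewrite inE => /orP[/eqP -> _|s'ts s't]; rewrite ge_min.
  by rewrite lexx orbT.
by rewrite Hd.
Qed.

(** A jump larger than 1/(n+1) can only sit at a cut of the partition for 1/(n+1), so all jump times
    lie in a countable union of finite sets. *)
Lemma countable_jumps x : cadlag01 x ->
  countable [set t | 0 <= t <= 1 /\ jump x t != 0].
Proof.
move=> cx.
have e0 n : 0 < n.+1%:R^-1 :> R by rewrite invr_gt0.
have /choice[ts Hts] : forall n : nat, exists ts : seq R, forall p q, 0 <= p ->
    p < q -> q <= 1 -> (forall t, t \in ts -> ~ (p < t <= q)) ->
    `|x p - x q| < n.+1%:R^-1.
  by move=> n; exact: cadlag_partition.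
suff H : [set t | 0 <= t <= 1 /\ jump x t != 0] `<=` \bigcup_n [set` ts n].
  apply: sub_countable (subset_card_le H) _.
  by apply: bigcup_countable => // n _; apply: finite_set_countable; exact: finite_seq.
move=> t [t01 jt].
have t0 : 0 < t.
  rewrite lt_neqAle; case/andP: t01 => -> _; rewrite andbT.
  by apply: contra jt => /eqP <-; rewrite /jump eqxx.
have [n Hn] : exists n : nat, n.+1%:R^-1 < `|jump x t|.
  by apply: invrS_lt; rewrite normr_gt0.
exists n => //=.
have [|d d0 Hd] := jump_detect cx _ Hn; first lra.
apply/negPn/negP => tts.
have [d' d'0 Hd'] := seq_gap (ts n) t.
(* Small enough that t - r/2 stays in [0, 1], detects the jump, and has no cut between itself and
   t. *)
pose r := Num.min (Num.min d d') t.
have r0 : 0 < r by rewrite /r !lt_min d0 d'0.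
have [rd rd' rt] : [/\ r <= d, r <= d' & r <= t].
  by split; rewrite /r !ge_min lexx ?orbT.
clearbody r.
have := Hd (t - r / 2) t.
have := Hts n (t - r / 2) t.
set v := `|_ - _| => H1 H2.
have nv : n.+1%:R^-1 < v by apply: H2; lra.
suff : v < n.+1%:R^-1 by move/(lt_trans nv); rewrite ltxx.
apply: H1; try lra.
move=> s sts /andP[s1 s2].
have /Hd' := sts; have [st|st /(_ isT)] := eqVneq s t.
  by rewrite -st sts in tts.
rewrite ler0_norm; lra.
Qed.

Lemma rat_approx_left t d : 0 < t -> 0 < d ->
  exists p : rat, [/\ 0 <= ratr p :> R, t - d < ratr p & ratr p < t].
Proof.
move=> t0 d0; have [|p] := @rat_in_itvoo R (Num.max 0 (t - d)) t.
  by rewrite gt_max t0; lra.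
rewrite in_itv /= gt_max => /andP[/andP[p0 pd] pt]; exists p.
by split => //; exact: ltW.
Qed.

Lemma rat_approx_right t d : t <= 1 -> 0 < d ->
  exists q : rat, [/\ ratr q <= 1 :> R, t <= ratr q & ratr q < t + d].
Proof.
move=> t1 d0; have [t1'|t1'] := ltP t 1; last first.
  by exists 1; rewrite rmorph1; split; lra.
have [|p] := @rat_in_itvoo R t (Num.min 1 (t + d)).
  by rewrite lt_min t1'; lra.
rewrite in_itv /= lt_min => /andP[tp /andP[p1 pd]]; exists p.
by split => //; exact: ltW.
Qed.

(** The second form speaks of values at rationals with countable quantifiers, which makes the
    absence of common jumps measurable. If there is no common jump, near each t one of the functions
    varies by less than e, and Cousin's lemma makes the scale uniform. *)
Lemma common_jumpP x y : cadlag01 x -> cadlag01 y ->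
  (exists t, 0 <= t <= 1 /\ jump x t * jump y t != 0) <->
  exists m : nat, forall k : nat, exists p q : rat,
    [/\ 0 <= ratr p :> R, ratr p < ratr q :> R & ratr q <= 1 :> R] /\
    [/\ ratr q - ratr p < k.+1%:R^-1 :> R,
        m.+1%:R^-1 < `|x (ratr p) - x (ratr q)| &
        m.+1%:R^-1 < `|y (ratr p) - y (ratr q)|].
Proof.
move=> cx cy; split=> [[t [t01]]|[m Hm]].
  rewrite mulf_eq0 negb_or => /andP[jx jy].
  have t0 : 0 < t.
    rewrite lt_neqAle; case/andP: t01 => -> _; rewrite andbT.
    by apply: contra jx => /eqP <-; rewrite /jump eqxx.
  have {}t01 : 0 < t <= 1 by lra.
  have [m] : exists m : nat, m.+1%:R^-1 < Num.min `|jump x t| `|jump y t|.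
    by apply: invrS_lt; rewrite lt_min !normr_gt0 jx.
  rewrite lt_min => /andP[mx my]; exists m => k.
  have [d1 d10 H1] := jump_detect cx t01 mx.
  have [d2 d20 H2] := jump_detect cy t01 my.
  have k0 : 0 < k.+1%:R^-1 :> R by rewrite invr_gt0.
  move: (k.+1%:R^-1) k0 => ik k0.
  pose d := Num.min (Num.min d1 d2) (ik / 2).
  have d0 : 0 < d by rewrite /d !lt_min d10 d20; lra.
  have [dd1 dd2 dk] : [/\ d <= d1, d <= d2 & d <= ik / 2].
    by split; rewrite /d !ge_min lexx ?orbT.
  have [p [p0 dp pt]] := rat_approx_left t0 d0.
  have [|q [q1 tq qd]] := @rat_approx_right t d _ d0; first lra.
  exists p, q; split; split; try lra.
  - by apply: H1; lra.
  - by apply: H2; lra.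
apply: contrapT => Hno.
have e0 : 0 < m.+1%:R^-1 :> R by rewrite invr_gt0.
move: (m.+1%:R^-1) e0 Hm => e e0 Hm.
have m0 : 0 < e / 2 by lra.
(* Only the left point p is confined to [a, b], so a pair straddling a division point needs no
   splitting when intervals are glued. *)
pose Q a b := exists k : nat, forall p q, a <= p -> p <= b -> 0 <= p ->
  p < q -> q <= 1 -> q - p < k.+1%:R^-1 -> e < `|x p - x q| ->
  e < `|y p - y q| -> False.
have [k Hk] : Q 0 1; last first.
  have [p [q [[p0 pq q1] [qpk xpq ypq]]]] := Hm k.
  by apply: (Hk (ratr p) (ratr q)) => //; lra.
apply: cousin.
  move=> a b c a0 ab bc c1 [k1 H1] [k2 H2]; exists (maxn k1 k2).
  have k12 i : (i <= maxn k1 k2)%N ->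
      (maxn k1 k2).+1%:R^-1 <= i.+1%:R^-1 :> R.
    by move=> ik; rewrite lef_pV2 ?posrE// ler_nat.
  move: (k12 _ (leq_maxl k1 k2)) (k12 _ (leq_maxr k1 k2)) H1 H2.
  move: (_.+1%:R^-1) (k1.+1%:R^-1) (k2.+1%:R^-1) => i i1 i2 k1le k2le H1 H2.
  move=> p q ap pc p0 pq q1 qpk; have [pb|bp] := leP p b.
    by apply: H1 => //; lra.
  by apply: H2 => //; lra.
move=> t t01.
have [d d0 Hd] : exists2 d, 0 < d & forall p q, 0 <= p -> p <= 1 -> 0 <= q ->
    q <= 1 -> t - d < p -> p < t + d -> t - d < q -> q < t + d ->
    e < `|x p - x q| -> e < `|y p - y q| -> False.
  have aux z : cadlag01 z -> jump z t = 0 -> exists2 d, 0 < d & forall p q,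
      0 <= p -> p <= 1 -> 0 <= q ->
      q <= 1 -> t - d < p -> p < t + d -> t - d < q -> q < t + d ->
      `|z p - z q| < e.
    move=> cz jz; have [d d0 Hd] := jump0_continuous cz t01 jz m0.
    exists d => // p q p0 p1 q0 q1 h1 h2 h3 h4.
    have -> : z p - z q = (z p - z t) - (z q - z t) by ring.
    by rewrite (le_lt_trans (ler_normB _ _))// [ltRHS]splitr ltrD// Hd//.
  have [jx|jx] := eqVneq (jump x t) 0.
    have [d d0 Hd] := aux _ cx jx; exists d => // p q h1 h2 h3 h4 h5 h6 h7 h8.
    by have := Hd p q h1 h2 h3 h4 h5 h6 h7 h8 => /lt_trans H /H; rewrite ltxx.
  have [jy|jy] := eqVneq (jump y t) 0.
    have [d d0 Hd] := aux _ cy jy; exists d => // p q h1 h2 h3 h4 h5 h6 h7 h8.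
    by move=> _; have := Hd p q h1 h2 h3 h4 h5 h6 h7 h8 => /lt_trans H /H;
      rewrite ltxx.
  by exfalso; apply: Hno; exists t; split => //; rewrite mulf_neq0.
have d20 : 0 < d / 2 by lra.
have [k Hk] := invrS_lt d20.
(* Half the radius for p, the other half for the gap q - p. *)
exists (d / 2) => // a b a0 ta at_ tb btd b1; exists k.
move: (k.+1%:R^-1) Hk => ik Hk p q ap pb p0 pq q1 qpk.
by apply: Hd; lra.
Qed.

End cadlag_jumps.

(** * Oscillation chains and regular limits of sequences *)

Section oscillations.
Context {R : realType}.
Implicit Types (x : R -> R) (v : rat -> R) (u : nat -> rat -> R) (t e : R).

(** Bounding the length of such chains for every [e] is the countable substitute for the existence
    of one-sided limits. The intervals may touch and come in any order. *)
Definition osc_chain v e (l : seq (rat * rat)) : bool :=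
  all (fun a => [&& 0 <= a.1, a.1 < a.2, a.2 <= 1 & e < `|v a.1 - v a.2|]) l &&
  pairwise (fun a b => (a.2 <= b.1) || (b.2 <= a.1)) l.

(** Each interval of a chain contains a cut of the partition for [e]; as the intervals are disjoint,
    distinct ones contain distinct cuts. *)
Lemma cadlag_chain_bound x e : cadlag01 x -> 0 < e ->
  exists K, forall l, osc_chain (x \o ratr) e l -> (size l <= K)%N.
Proof.
move=> cx e0; have [ts Hts] := cadlag_partition cx e0.
exists (size ts) => l /andP[/allP al pl].
pose hit (a : rat * rat) t := (ratr a.1 < t) && (t <= ratr a.2).
pose g a := nth 0 ts (find (hit a) ts).
have has_hit a : a \in l -> has (hit a) ts.
  move=> /al /and4P[a0 a12 a1 ea]; apply/negPn/negP => /hasPn Hno.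
  suff : `|x (ratr a.1) - x (ratr a.2)| < e by move/(lt_trans ea); rewrite ltxx.
  apply: Hts; rewrite ?ltr_rat ?ler0q//.
    by rewrite -(rmorph1 (@ratr R)) ler_rat.
  by move=> t /Hno /negP.
have hit_g a : a \in l -> hit a (g a) by move=> /has_hit; exact: nth_find.
rewrite -(size_map g); apply: uniq_leq_size; last first.
  move=> _ /mapP[a al' ->]; rewrite mem_nth// -has_find; exact: has_hit.
rewrite map_inj_in_uniq.
  (* The conjunct a.1 < a.2 makes the relation irreflexive, as needed to deduce that the chain has
     no repetition. *)
  apply: (@pairwise_uniq _ (fun a b : rat * rat =>
    ((a.2 <= b.1) || (b.2 <= a.1)) && (a.1 < a.2))).
    by move=> a /=; rewrite orbb; case: leP.
  move: pl al; elim: l {has_hit hit_g} => //= a l IH /andP[aP lP] al.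
  rewrite IH ?andbT//; last by move=> b bl; apply: al; rewrite inE bl orbT.
  apply/allP => b bl; move/allP : aP => /(_ _ bl) -> /=.
  by have /and4P[] := al _ (mem_head _ _).
move=> a b ain bin gab; apply/eqP/negPn/negP => ab.
have := hit_g _ ain; have := hit_g _ bin; rewrite gab => /andP[b1 b2] /andP[a1 a2].
have : (a.2 <= b.1) || (b.2 <= a.1).
  move: pl ain bin; elim: (l) => //= c s IH /andP[/allP cs ps].
  rewrite !inE => /orP[/eqP ac|ains] /orP[/eqP bc|bins].
  - by rewrite ac bc eqxx in ab.
  - by rewrite ac; exact: cs.
  - by rewrite bc orbC; exact: cs.
  - exact: IH.
rewrite -!(ler_rat R) => /orP[h|h].
  by have := le_lt_trans (le_trans a2 h) b1; rewrite ltxx.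
by have := le_lt_trans (le_trans b2 h) a1; rewrite ltxx.
Qed.

(** Formulated without the limit: a chain of the limit is replaced by a chain of [u n] for all large
    n. *)
Definition regular_limit u : Prop :=
  (forall q, 0 <= q <= 1 -> cvgn (u ^~ q)) /\
  forall m : nat, exists K : nat, forall l, size l = K ->
    ~ \forall n \near \oo, osc_chain (u n) m.+1%:R^-1 l.

Lemma cadlag_regular_limit x u : cadlag01 x ->
  (forall q, 0 <= q <= 1 -> u n q @[n --> \oo] --> x (ratr q)) ->
  regular_limit u.
Proof.
move=> cx ux; split=> [q q01|m].
  by apply/cvg_ex; exists (x (ratr q)); exact: ux.
set e := m.+1%:R^-1; have e0 : 0 < e by rewrite invr_gt0.
(* A strict bound by e becomes a weak one in the limit; e/2 restores strictness. *)
have [|K HK] := @cadlag_chain_bound x (e / 2) cx; first lra.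
exists K.+1 => l sl Hl; suff : (size l <= K)%N by rewrite sl ltnn.
apply: HK; apply/andP; split; last first.
  by have [n _ /(_ n (leqnn n)) /andP[]] := Hl.
apply/allP => a ain.
have al : \forall n \near \oo,
    [&& 0 <= a.1, a.1 < a.2, a.2 <= 1 & e < `|u n a.1 - u n a.2|].
  by apply: filterS Hl => n /andP[/allP /(_ _ ain)].
have [N _ /(_ N (leqnn N)) /and4P[a0 a12 a1 _]] := al.
apply/and4P; split => //=; apply: (@lt_le_trans _ _ e); first lra.
have cv : `|u n a.1 - u n a.2| @[n --> \oo] -->
    `|x (ratr a.1) - x (ratr a.2)|.
  by apply: cvg_norm; apply: cvgB; apply: ux; lra.
rewrite -(cvg_lim (@Rhausdorff R) cv); apply: limr_ge.
  by apply/cvg_ex; eexists; exact: cv.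
by apply: filterS al => n /and4P[_ _ _ /ltW].
Qed.

(** Positivity of the product says that p and q lie strictly on the same side of t. If oscillating
    pairs existed arbitrarily close to t, choosing each one closer than all its predecessors would
    give chains of every length. *)
Lemma regular_limit_local u t e : regular_limit u -> 0 < e ->
  exists2 d, 0 < d & forall p q : rat,
    0 <= p <= 1 -> 0 <= q <= 1 -> 0 < (ratr p - t) * (ratr q - t) ->
    `|ratr p - t| < d -> `|ratr q - t| < d ->
    ~ \forall n \near \oo, e < `|u n p - u n q|.
Proof.
move=> [_ reg] e0; apply: contrapT => Hno.
have bad d : 0 < d -> exists p q : rat,
    [/\ 0 <= p, p < q & q <= 1] /\
    [/\ 0 < (ratr p - t) * (ratr q - t), `|ratr p - t| < d, `|ratr q - t| < d &
     \forall n \near \oo, e < `|u n p - u n q|].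
  move=> d0; apply: contrapT => Hd; apply: Hno; exists d => // p q p01 q01 s pd qd.
  have [pq|qp|->] := ltgtP p q => Hn; apply: Hd.
  - by exists p, q; split; split => //; lra.
  - exists q, p; split; split => //; try lra.
    by apply: filterS Hn => n; rewrite distrC.
  - case: Hn => n _ /(_ n (leqnn n)) /=; rewrite subrr normr0 => e0'.
    by have := lt_trans e0 e0'; rewrite ltxx.
have [m me] := invrS_lt e0.
have {reg}[K HK] := reg m.
(* The induction keeps a distance [d] between t and the chain, so that a new pair within [d] of t is
   disjoint from it. *)
suff [l [sl [_ [_ Hl]]]] : exists l, size l = K /\
    (exists2 d, 0 < d & forall a, a \in l ->
      ratr a.2 <= t - d \/ t + d <= ratr a.1) /\
    (forall a, a \in l -> a.1 < a.2) /\
    \forall n \near \oo, osc_chain (u n) m.+1%:R^-1 l by exact: (HK l).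
elim: K {HK} => [|K [l [sl [[d d0 Hd] [lp Hl]]]]].
  exists [::]; split => //; split; first by exists 1.
  by split => //; exact: nearW.
have [p [q [[p0 pq q1] [s pd qd Hpq]]]] := bad _ d0.
have pqR : ratr p < ratr q :> R by rewrite ltr_rat.
have side : ratr q < t \/ t < ratr p.
  move: s; have [pt|tp|->] := ltgtP (ratr p) t.
  - by rewrite nmulr_rgt0 ?subr_lt0// => qt; left.
  - by right.
  - by rewrite subrr mul0r ltxx.
exists ((p, q) :: l); split; first by rewrite /= sl.
split.
  case: side => [qt|tp].
    exists (Num.min d (t - ratr q)); first by rewrite lt_min d0 subr_gt0.
    move=> a; rewrite inE => /orP[/eqP ->/=|/Hd[h|h]].
    - by left; rewrite lerBrDr -lerBrDl ge_min lexx orbT.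
    - by left; rewrite (le_trans h)// lerB// ge_min lexx.
    - by right; rewrite (le_trans _ h)// lerD// ge_min lexx.
  exists (Num.min d (ratr p - t)); first by rewrite lt_min d0 subr_gt0.
  move=> a; rewrite inE => /orP[/eqP ->/=|/Hd[h|h]].
  - by right; rewrite addrC -lerBrDr ge_min lexx orbT.
  - by left; rewrite (le_trans h)// lerB// ge_min lexx.
  - by right; rewrite (le_trans _ h)// lerD// ge_min lexx.
split; first by move=> a; rewrite inE => /orP[/eqP ->//|/lp].
have key : all (fun b : rat * rat => (q <= b.1) || (b.2 <= p)) l.
  apply/allP => b bl; rewrite -!(ler_rat R).
  move: pd qd; rewrite !ltr_norml => /andP[p1' p2'] /andP[q1' q2'].
  by case: (Hd _ bl) => h; apply/orP; [right|left]; lra.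
apply: filterS2 Hpq Hl => n Hpq /andP[aL pL].
by rewrite /osc_chain /= key p0 pq q1 (lt_trans me Hpq) aL.
Qed.

Definition uniformly_cauchy u : Prop :=
  forall m : nat, exists N : nat, forall n k, (N <= n)%N -> (N <= k)%N ->
    forall q : rat, 0 <= q <= 1 -> `|u n q - u k q| <= m.+1%:R^-1.

Lemma cadlag_rat_dense x t e : cadlag01 x -> 0 <= t <= 1 -> 0 < e ->
  exists2 d, 0 < d & forall q : rat, 0 <= q <= 1 -> t <= ratr q ->
    ratr q < t + d -> `|x (ratr q) - x t| < e.
Proof.
move=> cx t01 e0; have [t1|t1] := ltP t 1.
  have [|d d0 Hd] := @cadlag_right _ x t e cx _ e0; first lra.
  by exists d => // q _; exact: Hd.
exists 1 => // q q01 tq _; have -> : ratr q = t.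
  have : ratr q <= 1 :> R by rewrite -(rmorph1 (@ratr R)) ler_rat; case/andP: q01.
  by move=> ?; lra.
by rewrite subrr normr0.
Qed.

(** Right continuity of [x] and of [y n] carries the bound from rationals to every t, with an
    arbitrarily small loss; at t = 1 the rational used is 1 itself. *)
Lemma uniformly_cauchy_cvg x (y : nat -> R -> R) : cadlag01 x ->
  (forall n, cadlag01 (y n)) ->
  (forall q : rat, 0 <= q <= 1 -> y n (ratr q) @[n --> \oo] --> x (ratr q)) ->
  uniformly_cauchy (fun n q => y n (ratr q)) ->
  forall e, 0 < e -> exists N : nat, forall n, (N <= n)%N ->
    forall t, 0 <= t <= 1 -> `|y n t - x t| <= e.
Proof.
move=> cx cy yx uc e e0; have [m me] := invrS_lt e0.
have [N HN] := uc m; exists N => n Nn t t01.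
have Hq (q : rat) : 0 <= q <= 1 -> `|y n (ratr q) - x (ratr q)| <= m.+1%:R^-1.
  move=> q01.
  have cv : `|y n (ratr q) - y k (ratr q)| @[k --> \oo] -->
      `|y n (ratr q) - x (ratr q)|.
    by apply: cvg_norm; apply: cvgB; [exact: cvg_cst | exact: yx].
  rewrite -(cvg_lim (@Rhausdorff R) cv); apply: limr_le.
    by apply/cvg_ex; eexists; exact: cv.
  by exists N => // k Nk; exact: HN.
apply/ler_addgt0Pr => r r0; have r20 : 0 < r / 2 by lra.
have [d1 d10 H1] := cadlag_rat_dense cx t01 r20.
have [d2 d20 H2] := cadlag_rat_dense (cy n) t01 r20.
have d0 : 0 < Num.min d1 d2 by rewrite lt_min d10.
have [|q [q1 tq qd]] := @rat_approx_right R t _ _ d0; first lra.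
have q01 : 0 <= q <= 1.
  rewrite -(ler0q R) -(ler_rat R) rmorph1 q1 andbT.
  by case/andP: t01 => t0 _; exact: le_trans tq.
have Hx : `|x (ratr q) - x t| < r / 2.
  by apply: H1 => //; rewrite (lt_le_trans qd)// lerD2l ge_min lexx.
have Hy : `|y n (ratr q) - y n t| < r / 2.
  by apply: H2 => //; rewrite (lt_le_trans qd)// lerD2l ge_min lexx orbT.
have := Hq _ q01; move: (m.+1%:R^-1) me => im me Hxy.
have -> : y n t - x t = - (y n (ratr q) - y n t)
    + (y n (ratr q) - x (ratr q)) + (x (ratr q) - x t) by ring.
rewrite (le_trans (ler_normD _ _))//.
have := ler_normD (- (y n (ratr q) - y n t)) (y n (ratr q) - x (ratr q)).
rewrite normrN; lra.
Qed.

End oscillations.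

(** * Jumps under finite sums and uniform limits *)

Section jump_limits.
Context {R : realType}.
Implicit Types (x : R -> R) (t e l : R).

Lemma jump_left_lim x t l : 0 < t -> x u @[u --> t^'-] --> l ->
  jump x t = x t - l.
Proof.
by move=> t0 /(cvg_lim (@Rhausdorff R)) xl; rewrite /jump gt_eqF// xl.
Qed.

Lemma cadlag_left_lim x t : cadlag01 x -> 0 < t <= 1 ->
  x u @[u --> t^'-] --> x t - jump x t.
Proof.
move=> [_ xl] t01; rewrite /jump gt_eqF; last by case/andP: t01.
by rewrite opprB addrC subrK; exact: xl.
Qed.

Lemma cadlag_sum (c : nat -> R) (x : nat -> R -> R) n :
  (forall j, cadlag01 (x j)) -> cadlag01 (fun t => \sum_(j < n) c j * x j t).
Proof.
move=> cx; split=> t t01.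
  apply: (cvg_big add_continuous) => j _; apply: cvgM; first exact: cvg_cst.
  by have [xr _] := cx j; exact: xr.
apply/cvg_ex; exists (\sum_(j < n) c j * (x j t - jump (x j) t)).
apply: (cvg_big add_continuous) => j _; apply: cvgM; first exact: cvg_cst.
exact: cadlag_left_lim.
Qed.

Lemma jump_sum (c : nat -> R) (x : nat -> R -> R) n t :
  (forall j, cadlag01 (x j)) -> 0 <= t <= 1 ->
  jump (fun t => \sum_(j < n) c j * x j t) t = \sum_(j < n) c j * jump (x j) t.
Proof.
move=> cx t01; have [->|t0] := eqVneq t 0.
  rewrite /jump eqxx big1// => j _; first by rewrite mulr0.
have {}t01 : 0 < t <= 1 by rewrite lt0r t0.
rewrite (@jump_left_lim _ _ (\sum_(j < n) c j * (x j t - jump (x j) t))).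
- by rewrite -sumrB; apply: eq_bigr => j _; ring.
- by case/andP: t01.
- apply: (cvg_big add_continuous) => j _; apply: cvgM; first exact: cvg_cst.
  exact: cadlag_left_lim.
Qed.

(** A uniform bound on [y n - x] survives the passage to left limits, so the jumps differ by at most
    twice that bound. *)
Lemma jump_cvg x (y : nat -> R -> R) t : cadlag01 x ->
  (forall n, cadlag01 (y n)) ->
  (forall e, 0 < e -> exists N : nat, forall n, (N <= n)%N ->
    forall s, 0 <= s <= 1 -> `|y n s - x s| <= e) ->
  0 <= t <= 1 -> jump (y n) t @[n --> \oo] --> jump x t.
Proof.
move=> cx cy yx t01; have [->|t0] := eqVneq t 0.
  by rewrite /jump eqxx; exact: cvg_cst.
have {}t01 : 0 < t <= 1 by rewrite lt0r t0.
apply/cvgrPdist_le => e e0; have e20 : 0 < e / 2 by lra.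
have [N HN] := yx _ e20; exists N => // n /= Nn.
have Hl : `|(y n t - jump (y n) t) - (x t - jump x t)| <= e / 2.
  have cv : `|y n u - x u| @[u --> t^'-] -->
      `|(y n t - jump (y n) t) - (x t - jump x t)|.
    by apply: cvg_norm; apply: cvgB; exact: cadlag_left_lim.
  rewrite -(cvg_lim (@Rhausdorff R) cv); apply: limr_le.
    by apply/cvg_ex; eexists; exact: cv.
  near=> u; apply: HN => //; apply/andP; split.
    near: u; apply: nbhs_left_ge; lra.
  have : u <= t by near: u; exact: nbhs_left_le.
  by lra.
have Ht : `|y n t - x t| <= e / 2 by apply: HN => //; lra.
have -> : jump x t - jump (y n) t =
  ((y n t - jump (y n) t) - (x t - jump x t)) - (y n t - x t) by ring.
by rewrite (le_trans (ler_normB _ _))// [leRHS]splitr lerD.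
Unshelve. all: by end_near. Qed.

(** One sequence serves all cadlag functions. Hence the jump at t is a pointwise limit of
    increments, which gives its measurability and links it to continuity in probability. *)
Lemma jump_seq t : 0 < t <= 1 -> exists v : nat -> R,
  [/\ forall n, 0 <= v n <= 1, v n @[n --> \oo] --> t &
      forall x, cadlag01 x -> x t - x (v n) @[n --> \oo] --> jump x t].
Proof.
move=> t01; pose v n := t - t / n.+1%:R.
have vt n : v n < t.
  by rewrite /v ltrBlDr ltrDl divr_gt0//; case/andP: t01.
have vcvg : v n @[n --> \oo] --> t.
  rewrite -[X in _ --> X]subr0 -[X in _ - X](mulr0 t).
  apply: cvgB; first exact: cvg_cst.
  by apply: cvgM; [exact: cvg_cst | exact: cvg_harmonic].
exists v; split => // [n|x cx].
  apply/andP; split; last by rewrite (le_trans (ltW (vt n)))//; case/andP: t01.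
  rewrite subr_ge0 ler_pdivrMr// ler_peMr// ?ler1n//.
  by case/andP: t01 => /ltW.
have xl := cadlag_left_lim cx t01.
rewrite [X in _ --> X](_ : _ = x t - (x t - jump x t)); last first.
  by rewrite opprB addrC subrK.
apply: cvgB; first exact: cvg_cst.
apply: (cvg_comp v x _ xl) => U [e /= e0 eU].
by move/cvgrPdist_lt : vcvg => /(_ _ e0); apply: filterS => n /= tv; apply: eU.
Qed.

End jump_limits.

(** * Measurability under countable quantifiers *)

Section countable_quantifiers.
Context {d} {T : measurableType d} (U : countType) (F : U -> set T).
Hypothesis mF : forall u, measurable (F u).

Lemma measurable_exists : measurable [set x | exists u, F u x].
Proof.
rewrite (_ : [set _ | _] = \bigcup_u F u).
  by apply: countable_bigcupT_measurable => //; exact: countableP.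
by apply/seteqP; split=> x [u]; exists u.
Qed.

End countable_quantifiers.

Lemma measurable_forall {d} {T : measurableType d} (U : countType)
    (F : U -> set T) : (forall u, measurable (F u)) ->
  measurable [set x | forall u, F u x].
Proof.
move=> mF; rewrite (_ : [set _ | _] = ~` [set x | exists u, (~` F u) x]).
  by apply/measurableC/measurable_exists => u; exact: measurableC.
apply/seteqP; split=> x /=; first by move=> Fx [u]; exact.
by move=> nF u; apply: contrapT => Fu; apply: nF; exists u.
Qed.

(** * Coin tossing space and its zero-one law *)

Section coin_space.

Definition cyl (s : seq bool) : set (nat -> bool) :=
  [set x | forall i, (i < size s)%N -> x i = nth false s i].

(** The empty set is added for closure under intersection, since incompatible prefixes have disjoint
    cylinders. *)
Definition cylinders : set_system (nat -> bool) :=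
  [set A | A = set0 \/ exists s, A = cyl s].

Definition coins := g_sigma_algebraType cylinders.

(** Two patterns [b] matter: finitely supported ones, for the zero-one law and single flips, and
    [leq k], which reverses all signs from k on. *)
Definition flip (b : nat -> bool) (x : coins) : coins := fun i => x i (+) b i.

Lemma cyl_nil : cyl [::] = setT.
Proof. by apply/seteqP; split. Qed.

Lemma measurable_cyl s : measurable (cyl s : set coins).
Proof. by apply: sub_sigma_algebra; right; exists s. Qed.

Lemma setI_closed_cylinders : setI_closed cylinders.
Proof.
move=> A B [->|[s ->]]; first by left; rewrite set0I.
move=> [->|[s' ->]]; first by left; rewrite setI0.
have aux (u v : seq bool) : (size u <= size v)%N -> cylinders (cyl u `&` cyl v).
  move=> uv; have [tv|tv] := eqVneq (take (size u) v) u.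
    right; exists v; apply/seteqP; split=> [x []//|x xv]; split => // i iu.
    by rewrite xv ?(leq_trans iu)// -[in RHS]tv nth_take.
  left; apply/seteqP; split=> // x [xu xv]; move/eqP: tv; apply.
  apply: (@eq_from_nth _ false); first by rewrite size_takel.
  move=> i; rewrite size_takel// => iu.
  by rewrite nth_take// -xu// -xv// (leq_trans iu).
have [ss'|s's] := leqP (size s) (size s'); first exact: aux.
by rewrite setIC; apply: aux; exact: ltnW.
Qed.

Lemma preimage_flip_cyl b s : flip b @^-1` cyl s =
  cyl (mkseq (fun i => nth false s i (+) b i) (size s)).
Proof.
apply/seteqP; split=> x /= xs i.
  by rewrite size_mkseq => i_s; rewrite nth_mkseq// -xs// /flip addbK.
move=> i_s; have := xs i; rewrite size_mkseq => /(_ i_s).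
by rewrite nth_mkseq// /flip => ->; rewrite addbK.
Qed.

Lemma measurable_flip b : measurable_fun setT (flip b).
Proof.
apply: (@measurability _ _ coins coins setT (flip b) cylinders) => //.
move=> _ [_ [->|[s ->]] <-]; first by rewrite preimage_set0 setI0.
by rewrite setTI preimage_flip_cyl; exact: measurable_cyl.
Qed.

HB.instance Definition _ b :=
  @isMeasurableFun.Build _ _ coins coins (flip b) (measurable_flip b).

Lemma measurable_coin j : measurable_fun setT (fun x : coins => x j).
Proof.
apply: (measurable_fun_bool true); rewrite setTI.
rewrite (_ : _ @^-1` _ = [set x : coins | exists s : seq bool,
    (if (size s == j.+1) && nth false s j then cyl s else set0) x]).
  apply: measurable_exists => s; case: ifP => // _; exact: measurable_cyl.
apply/seteqP; split=> [x /= xj|x [s]]; last first.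
  by case: ifP => // /andP[/eqP ss sj] /(_ j); rewrite ss ltnSn /= => ->.
exists (mkseq x j.+1); rewrite size_mkseq eqxx nth_mkseq//= xj.
by move=> i; rewrite size_mkseq => ij; rewrite nth_mkseq.
Qed.

Context {R : realType}.

Definition sg (c : bool) : R := if c then 1 else -1.

Lemma sgN c : sg (~~ c) = - sg c.
Proof. by case: c; rewrite /sg /= ?opprK. Qed.

Lemma measurable_sg_coin j : measurable_fun setT (fun x : coins => sg (x j)).
Proof. by apply: measurable_fun_ifT => //; exact: measurable_coin. Qed.

Lemma coin_measure_ext (m1 m2 : {measure set coins -> \bar R}) :
  (m1 setT < +oo)%E -> (forall s, m1 (cyl s) = m2 (cyl s)) ->
  forall A, measurable A -> m1 A = m2 A.
Proof.
move=> m1oo m12; apply: (@measure_unique _ R coins cylinders (fun _ => setT)) => //.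
- exact: setI_closed_cylinders.
- by move=> _; right; exists [::]; rewrite cyl_nil.
- by rewrite bigcup_const.
- by move=> A [->|[s ->]//]; rewrite !measure0.
Qed.

(** A property instead of a constructed product measure: the joint law of the signs of [eps] will
    satisfy it. *)
Definition fair (mu : set coins -> \bar R) :=
  forall s, mu (cyl s) = (2^-1 ^+ size s)%:E.

Variable mu : probability coins R.
Hypothesis mu_fair : fair mu.

(** A flip permutes the cylinders of each length, and these all have the same mass. *)
Lemma fair_flip b A : measurable A -> mu (flip b @^-1` A) = mu A.
Proof.
move=> mA; apply: (@coin_measure_ext (distribution mu (flip b)) mu) => //.
  by apply: le_lt_trans (probability_le1 (distribution mu (flip b)) measurableT) _; rewrite ltry.
move=> s; transitivity (mu (flip b @^-1` cyl s)) => //.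
rewrite preimage_flip_cyl !mu_fair size_mkseq. exact: (esym (mu_fair s)).
Qed.

(** Flipping the coin after a prefix exchanges the two halves of its cylinder and preserves A, so A
    has the same density in every cylinder. Thus A is independent of all cylinders, hence of itself,
    and its mass equals its own square. *)
Lemma fair_zero_one A : measurable A ->
  (forall b N, (forall i, (N <= i)%N -> b i = false) -> flip b @^-1` A = A) ->
  mu A != 1%E -> mu A = 0%E.
Proof.
move=> mA invA.
have half s c : mu (cyl (rcons s c) `&` A) = mu (cyl (rcons s (~~ c)) `&` A).
  pose b i := i == size s.
  rewrite -(@fair_flip b); last by apply: measurableI => //; exact: measurable_cyl.
  rewrite preimage_setI (invA b (size s).+1); last first.
    by move=> i si; rewrite /b gtn_eqF.
  congr (mu (_ `&` _)); rewrite preimage_flip_cyl; congr cyl.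
  apply: (@eq_from_nth _ false); rewrite size_mkseq !size_rcons// => i iS.
  rewrite nth_mkseq// !nth_rcons /b.
  move: iS; rewrite ltnS; have [i_s _|//|_ _] := ltngtP i (size s).
    by rewrite addbF.
  by rewrite addbT.
have split_cyl s : cyl s = cyl (rcons s true) `|` cyl (rcons s false).
  apply/seteqP; split=> [x xs|x [] xs i i_s].
  - have aux : cyl (rcons s (x (size s))) x.
      move=> i; rewrite size_rcons ltnS leq_eqVlt => /orP[/eqP ->|i_s].
        by rewrite nth_rcons ltnn eqxx.
      by rewrite nth_rcons i_s xs.
    by move: aux; case: (x _) => ?; [left|right].
  - by rewrite xs ?size_rcons 1?ltnW// nth_rcons i_s.
  - by rewrite xs ?size_rcons 1?ltnW// nth_rcons i_s.
have cylA s : mu (cyl s `&` A) = (mu A * (2^-1 ^+ size s)%:E)%E.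
  elim/last_ind: s => [|s c IH]; first by rewrite cyl_nil setTI /= expr0 mule1.
  have : mu (cyl s `&` A) = (mu (cyl (rcons s c) `&` A) *+ 2)%E.
    rewrite split_cyl setIUl measureU; first last.
    - apply/seteqP; split=> // x [[xt _] [xf _]].
      have := xt (size s); have := xf (size s); rewrite !size_rcons !nth_rcons.
      by rewrite ltnn eqxx ltnSn => /(_ isT) -> /(_ isT).
    - by apply: measurableI => //; exact: measurable_cyl.
    - by apply: measurableI => //; exact: measurable_cyl.
    rewrite mule2n; case: c; congr (_ + _)%E; first exact: (half s false).
    exact: (half s true).
  rewrite IH size_rcons.
  have fA : mu A \is a fin_num by exact: fin_num_measure.
  have fC : mu (cyl (rcons s c) `&` A) \is a fin_num.
    by apply: fin_num_measure; apply: measurableI => //; exact: measurable_cyl.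
  rewrite -(fineK fA) -(fineK fC) -EFinM mule2n -EFinD -EFinM => -[E].
  congr EFin; rewrite exprS; lra.
have fA : mu A \is a fin_num by exact: fin_num_measure.
have A0 : (0 <= fine (mu A))%R by exact: fine_ge0.
have H : mu (A `&` A) = ((fine (mu A))%:E * mu A)%E.
  (* The restriction of [mu] to A and the multiple of [mu] by the mass of A agree on cylinders, and
     are compared at A. *)
  apply: (@coin_measure_ext (mrestr mu mA) (mscale (NngNum A0) mu)) => //.
    change (mu (setT `&` A) < +oo)%E.
    rewrite -ge0_fin_numE//; apply: fin_num_measure; exact: measurableI.
  move=> s; change (mu (cyl s `&` A) = (fine (mu A))%:E * mu (cyl s))%E.
  by rewrite cylA mu_fair fineK.
move: H; rewrite setIid -(fineK fA) -EFinM => H.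
case: H => E; rewrite eqe => A1; congr EFin; apply/eqP.
have : fine (mu A) * (fine (mu A) - 1) == 0 by apply/eqP; lra.
by rewrite mulf_eq0 subr_eq0 (negPf A1) orbF.
Qed.

End coin_space.

(** * Measurable predicates *)

Section measurable_predicates.
Context {d} {T : measurableType d}.

(** The condition [Q] is deterministic and may be used in proving [F] measurable, for instance to
    know that a rational lies in [0, 1]. *)
Lemma measurable_and (Q : Prop) (F : set T) :
  (Q -> measurable F) -> measurable [set x | Q /\ F x].
Proof.
move=> mF; have [q|q] := pselect Q.
  by rewrite (_ : [set _ | _] = F); [exact: mF | apply/seteqP; split=> x //= []].
by rewrite (_ : [set _ | _] = set0)//; apply/seteqP; split=> x //= [].
Qed.

Lemma measurable_imply (Q : Prop) (F : set T) :
  (Q -> measurable F) -> measurable [set x | Q -> F x].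
Proof.
move=> mF; have [q|q] := pselect Q.
  rewrite (_ : [set _ | _] = F); first exact: mF.
  by apply/seteqP; split=> x //=; exact.
by rewrite (_ : [set _ | _] = setT)//; apply/seteqP; split=> x //= _ /q.
Qed.

Lemma measurable_near (F : nat -> set T) : (forall n, measurable (F n)) ->
  measurable [set x | \forall n \near \oo, F n x].
Proof.
move=> mF; rewrite (_ : [set _ | _] =
    [set x | exists N, [set x | forall n, [set x | (N <= n)%N -> F n x] x] x]).
  apply: measurable_exists => N; apply: measurable_forall => n.
  exact: measurable_imply.
apply/seteqP; split=> x [N].
  by move=> _ H; exists N => n Nn; exact: H.
by move=> H; exists N => // n Nn; exact: H.
Qed.

Context {R : realType}.

Lemma measurable_gt (u : T -> R) r : measurable_fun setT u ->
  measurable [set x | r < u x].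
Proof.
move=> mu; rewrite (_ : [set _ | _] = setT `&` u @^-1` `]r, +oo[%classic).
  exact: mu.
by rewrite setTI; apply/seteqP; split=> x /=; rewrite in_itv /= andbT.
Qed.

Lemma measurable_le (u : T -> R) r : measurable_fun setT u ->
  measurable [set x | u x <= r].
Proof.
move=> mu; rewrite (_ : [set _ | _] = setT `&` u @^-1` `]-oo, r]%classic).
  exact: mu.
by rewrite setTI; apply/seteqP; split=> x /=; rewrite in_itv /=.
Qed.

Lemma measurable_norm (u : T -> R) : measurable_fun setT u ->
  measurable_fun setT (fun x => `|u x|).
Proof. by move=> mu; exact: measurableT_comp. Qed.

End measurable_predicates.

(** * Rademacher series and Levy's inequality *)

Section rademacher.
Context {R : realType} (mu : probability coins R).
Hypothesis mu_fair : fair mu.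

Lemma ae_flip b (Q : coins -> Prop) : {ae mu, forall x, Q x} ->
  {ae mu, forall x, Q (flip b x)}.
Proof.
move=> [N [mN N0 QN]]; exists (flip b @^-1` N); split.
- rewrite -[X in measurable X]setTI; exact: measurable_flip.
- by rewrite fair_flip.
- by move=> x Qx; exact: QN.
Qed.

(** The index type will be the rationals for paths, pairs of rationals for increments, and [unit]
    for numerical series. *)
Definition rsum {I : Type} (h : nat -> I -> R) (x : coins) (n : nat) (i : I) : R :=
  \sum_(j < n) sg (x j) * h j i.

Lemma measurable_rsum {I : Type} (h : nat -> I -> R) n i :
  measurable_fun setT (fun x => rsum h x n i).
Proof.
apply: measurable_sum => j; apply: measurable_funM => //.
exact: measurable_sg_coin.
Qed.

Lemma rsum_flip_eq {I : Type} (h : nat -> I -> R) b n x i :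
  (forall j, (j < n)%N -> b j = false) -> rsum h (flip b x) n i = rsum h x n i.
Proof.
by move=> b0; apply: eq_bigr => j _; rewrite /flip b0// addbF.
Qed.

(** Reflection principle: the terms from k on cancel, those before k are doubled. *)
Lemma rsum_flip_tail {I : Type} (h : nat -> I -> R) k n x i : (k <= n)%N ->
  rsum h x n i + rsum h (flip (leq k) x) n i = 2 * rsum h x k i.
Proof.
move=> kn; rewrite -(subnKC kn); elim: (n - k)%N => [|m IH].
  rewrite addn0 rsum_flip_eq; first by rewrite mulr2n mulrDl !mul1r.
  by move=> j jk; rewrite leqNgt jk.
rewrite /rsum addnS !big_ord_recr /= -!/(rsum _ _ _ _) addrACA IH.
by rewrite /flip leq_addr addbT sgN mulNr subrr addr0.
Qed.

(** Changing the first N signs shifts all partial sums from N on by the same amount; this makes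
    [oscillates] invariant under finite sign changes. *)
Lemma rsum_flip_head {I : Type} (h : nat -> I -> R) b N n k x i :
  (forall j, (N <= j)%N -> b j = false) -> (N <= n)%N -> (N <= k)%N ->
  rsum h (flip b x) n i - rsum h (flip b x) k i = rsum h x n i - rsum h x k i.
Proof.
move=> b0; suff E m : (N <= m)%N ->
    rsum h (flip b x) m i - rsum h x m i = rsum h (flip b x) N i - rsum h x N i.
  move=> /E En /E Ek; have : rsum h (flip b x) n i - rsum h x n i =
    rsum h (flip b x) k i - rsum h x k i by rewrite En Ek.
  by move=> H; lra.
move=> Nm; rewrite -(subnKC Nm); elim: (m - N)%N => [|l IH]; first by rewrite addn0.
rewrite addnS -IH /rsum !big_ord_recr /= -!/(rsum _ _ _ _).
by rewrite /flip b0 ?leq_addr// addbF; ring.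
Qed.

Section levy.
Implicit Type r : R.
Variables (I : countType) (D : set I) (h : nat -> I -> R).
Hypothesis cvg_rsum :
  {ae mu, forall x, forall i, D i -> cvgn (fun n => rsum h x n i)}.

(** Plays the role of a large limit, but is expressed by partial sums and therefore visibly
    measurable. *)
Definition eventually_gt r : set coins :=
  [set x | exists i, D i /\ \forall n \near \oo, r < `|rsum h x n i|].

Definition sometimes_gt r : set coins :=
  [set x | exists k i, D i /\ r < `|rsum h x k i|].

Definition oscillates r : set coins :=
  [set x | forall N : nat, exists n k : nat, (N <= n)%N /\ (N <= k)%N /\
    exists i, D i /\ r < `|rsum h x n i - rsum h x k i|].

Let level r k : set coins := [set x | exists i, D i /\ r < `|rsum h x k i|].

Lemma measurable_level r k : measurable (level r k).
Proof.
apply: measurable_exists => i; apply: measurable_and => _.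
by apply: measurable_gt; apply: measurable_norm; exact: measurable_rsum.
Qed.

Lemma measurable_eventually_gt r : measurable (eventually_gt r).
Proof.
apply: measurable_exists => i; apply: measurable_and => _.
apply: measurable_near => n.
by apply: measurable_gt; apply: measurable_norm; exact: measurable_rsum.
Qed.

Lemma measurable_sometimes_gt r : measurable (sometimes_gt r).
Proof. by apply: measurable_exists => k; exact: measurable_level. Qed.

Lemma measurable_oscillates r : measurable (oscillates r).
Proof.
apply: measurable_forall => N; apply: measurable_exists => n.
apply: measurable_exists => k; apply: measurable_and => _.
apply: measurable_and => _; apply: measurable_exists => i.
apply: measurable_and => _; apply: measurable_gt; apply: measurable_norm.
by apply: measurable_funB; exact: measurable_rsum.
Qed.

(** By reflection the two limits add up to twice the k-th partial sum, so one of them exceeds [r] in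
    absolute value. *)
Lemma eventually_gt_flip r k x i : D i ->
  cvgn (fun n => rsum h x n i) -> cvgn (fun n => rsum h (flip (leq k) x) n i) ->
  r < `|rsum h x k i| ->
  eventually_gt r x \/ eventually_gt r (flip (leq k) x).
Proof.
move=> Di cx cy rk; set y := flip _ _ in cy *.
set lx := lim (rsum h x n i @[n --> \oo]) in cx.
set ly := lim (rsum h y n i @[n --> \oo]) in cy.
have E : lx + ly = 2 * rsum h x k i.
  apply: (cvg_unique (@Rhausdorff R) (cvgD cx cy)).
  by apply: cvg_near_cst; exists k => // n /= kn; exact: rsum_flip_tail.
have : r < `|lx| \/ r < `|ly|.
  have := ler_normD lx ly; rewrite E normrM ger0_norm//.
  have [?|?] := ltP r `|lx|; first by left.
  have [?|?] := ltP r `|ly|; first by right.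
  by lra.
have ev z l : rsum h z n i @[n --> \oo] --> l -> r < `|l| -> eventually_gt r z.
  move=> zl rl; exists i; split=> //.
  by apply: (cvgr_gt _ (cvg_norm zl)).
by case=> rl; [left; exact: ev cx rl|right; exact: ev cy rl].
Qed.

(** [B k] is the event that level r is first exceeded, at some index, at time k. Reversing the signs
    from k on preserves both [B k] and the measure, and by reflection one of the two sign choices
    lies in [E]; so at least half of [B k] lies in [E]. *)
Lemma levy_inequality r :
  (mu (sometimes_gt r) <= 2%:E * mu (eventually_gt r))%E.
Proof.
pose F := level r; have mF k : measurable (F k) by exact: measurable_level.
pose B := seqDU F; have mB k : measurable (B k) by exact: seqDU_measurable.
have mE := measurable_eventually_gt r; set E := eventually_gt r in mE *.
have mBE k : measurable (B k `&` E) by exact: measurableI.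
have -> : sometimes_gt r = \bigcup_k B k.
  by rewrite -seqDU_bigcup_eq; apply/seteqP; split=> x [k]; exists k.
rewrite measure_bigcup//; last exact: trivIset_seqDU.
have BE k : (mu (B k) <= 2%:E * mu (B k `&` E))%E.
  (* [F l] involves only the first l coins, which are untouched. *)
  have fF l x : (l <= k)%N -> F l (flip (leq k) x) = F l x.
    move=> lk; congr (exists i, _); apply/funext => i.
    by rewrite rsum_flip_eq// => j jl; rewrite leqNgt (leq_trans jl).
  have fB : flip (leq k) @^-1` B k = B k.
    apply/seteqP; split=> x; rewrite /B /seqDU /= fF// => -[Fk nF]; split=> // Fl;
      apply: nF; move: Fl; rewrite -!bigcup_mkord => -[l /= lk Fl];
      exists l => //; move: Fl; by rewrite fF// ltnW.
  have [N [mN N0 HN]] : mu.-negligible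
      (~` [set x | (forall i, D i -> cvgn (fun n => rsum h x n i)) /\
          forall i, D i -> cvgn (fun n => rsum h (flip (leq k) x) n i)]).
    have := ae_flip (leq k) cvg_rsum; move: cvg_rsum.
    by apply: filterS2 => x.
  have mfE : measurable (flip (leq k) @^-1` E).
    by rewrite -[X in measurable X]setTI; exact: measurable_flip.
  apply: (@le_trans _ _ (mu ((B k `&` E) `|` (B k `&` flip (leq k) @^-1` E) `|` N))).
    apply: le_measure; rewrite ?inE//.
      apply: measurableU => //; apply: measurableU => //; exact: measurableI.
    move=> x Bx; have [Nx|Nx] := pselect (N x); first by right.
    left; have [cx cy] : (forall i, D i -> cvgn (fun n => rsum h x n i)) /\
          forall i, D i -> cvgn (fun n => rsum h (flip (leq k) x) n i).
      by apply: contrapT => nc; apply: Nx; exact: HN.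
    have [[i [Di ri]] _] := Bx.
    by have [e|e] := eventually_gt_flip Di (cx _ Di) (cy _ Di) ri; [left|right].
  have mBfE : measurable (B k `&` flip (leq k) @^-1` E) by exact: measurableI.
  apply: le_trans (measureU2 _ _ _) _ => //; first exact: measurableU.
  rewrite [X in (_ + X <= _)%E](_ : _ = 0%E)// adde0; apply: le_trans (measureU2 _ _ _) _ => //.
  rewrite [X in (_ + X <= _)%E](_ : _ = mu (B k `&` E)); last first.
    rewrite -(fair_flip mu_fair (leq k) (mBE k)).
    by congr (mu _); rewrite preimage_setI fB.
  by rewrite -mule2n -mule_natl.
apply: (@le_trans _ _ (\sum_(0 <= k <oo) 2%:E * mu (B k `&` E))%E).
  rewrite [leLHS](_ : _ = (\sum_(0 <= k <oo) mu (B k))%E); last first.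
    by apply: eq_eseriesl => k; rewrite in_setT.
  exact: lee_nneseries.
rewrite nneseriesZl// lee_pmul2l//.
have : (mu (\bigcup_k (B k `&` E)) <= mu E)%E.
  apply: le_measure; rewrite ?inE//; first exact: bigcupT_measurable.
  by move=> x [k _ []].
apply: le_trans; rewrite measure_bigcup//; last first.
  by apply/trivIset_setIr; exact: trivIset_seqDU.
rewrite [leRHS](_ : _ = (\sum_(0 <= k <oo) mu (B k `&` E))%E)//.
by apply: eq_eseriesl => k; rewrite in_setT.
Qed.

(** An oscillation beyond 2r forces some partial sum beyond r, an event of probability below 1 by
    Levy's inequality; the zero-one law lowers this to 0. *)
Lemma oscillates_null r : (mu (eventually_gt r) < (2^-1)%:E)%E ->
  mu (oscillates (2 * r)) = 0%E.
Proof.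
move=> ev; apply: fair_zero_one => //; first exact: measurable_oscillates.
  move=> b M b0; apply/seteqP; split=> x Hx N;
    have [n [k [Nn [Nk [i [Di ri]]]]]] := Hx (maxn N M);
    move: Nn Nk; rewrite !geq_max => /andP[Nn Mn] /andP[Nk Mk];
    exists n, k; split => //; split => //; exists i; split => //;
    by move: ri; rewrite (rsum_flip_head _ _ _ b0).
apply/eqP => o1; suff : (mu (oscillates (2 * r)%R) < 1)%E by rewrite o1 ltxx.
apply: (@le_lt_trans _ _ (mu (sometimes_gt r))).
  apply: le_measure; rewrite ?inE//.
  - exact: measurable_oscillates.
  - exact: measurable_sometimes_gt.
  move=> x /(_ 0%N) [n [k [_ [_ [i [Di ri]]]]]].
  have := ler_normB (rsum h x n i) (rsum h x k i).
  have [?|?] := ltP r `|rsum h x n i|; first by exists n, i.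
  have [?|?] := ltP r `|rsum h x k i|; first by exists k, i.
  by lra.
apply: (le_lt_trans (levy_inequality r)).
rewrite (_ : 1%E = 2%:E * (2^-1)%:E)%E; first by rewrite lte_pmul2l.
by rewrite -EFinM mulfV.
Qed.

End levy.
End rademacher.

(** * Uniform Cauchy property from regular limits *)

Section rademacher_cauchy.
Context {R : realType} (mu : probability coins R).
Hypothesis mu_fair : fair mu.
Variable g : nat -> rat -> R.
Hypothesis g_regular : {ae mu, forall x, regular_limit (rsum g x)}.

Let near_pairs (t d : R) : set (rat * rat) := [set a |
  [/\ 0 <= a.1 <= 1, 0 <= a.2 <= 1, 0 < (ratr a.1 - t) * (ratr a.2 - t),
      `|ratr a.1 - t| < d & `|ratr a.2 - t| < d] ].

Let incr (j : nat) (a : rat * rat) : R := g j a.1 - g j a.2.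

Let rsum_incr x n a : rsum incr x n a = rsum g x n a.1 - rsum g x n a.2.
Proof. by rewrite /rsum -sumrB; apply: eq_bigr => j _; rewrite mulrBr. Qed.

Let cvg_rsum_incr t d :
  {ae mu, forall x, forall a, near_pairs t d a -> cvgn (fun n => rsum incr x n a)}.
Proof.
apply: filterS g_regular => x [cg _] a [a1 a2 _ _ _].
under eq_fun do rewrite rsum_incr.
by apply: is_cvgB; exact: cg.
Qed.

(** The events [A n] decrease with the neighbourhood, and their intersection contradicts the absence
    of large one-sided oscillation near t. By continuity from above one of them has probability
    below 1/2. *)
Let oscillates_local t e : 0 < e -> exists2 d, 0 < d &
  mu (oscillates (near_pairs t d) incr (2 * e)) = 0%E.
Proof.
move=> e0; pose A n := eventually_gt (near_pairs t n.+1%:R^-1) incr e.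
have mA n : measurable (A n) by exact: measurable_eventually_gt.
have mAI : measurable (\bigcap_n A n).
  exact: bigcapT_measurable.
have A0 : mu (\bigcap_n A n) = 0%E.
  apply/negligibleP => //; apply: negligibleS g_regular => x Ax reg.
  have [d d0 Hd] := regular_limit_local t reg e0.
  have [n nd] := invrS_lt d0.
  have [a [[a1 a2 a12 ad1 ad2] Ha]] := Ax n I.
  apply: (Hd a.1 a.2) => //; [exact: lt_trans nd|exact: lt_trans nd|].
  by apply: filterS Ha => k; rewrite rsum_incr.
have cvA : mu (A n) @[n --> \oo] --> 0%E.
  rewrite -A0; apply: nonincreasing_cvg_mu => //.
    by rewrite -ge0_fin_numE//; exact: fin_num_measure.
  move=> m n mn; apply/subsetPset => x [a [[a1 a2 a12 ad1 ad2] Ha]].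
  exists a; split => //; split => //.
    by apply: (lt_le_trans ad1); rewrite lef_pV2 ?posrE// ler_nat.
  by apply: (lt_le_trans ad2); rewrite lef_pV2 ?posrE// ler_nat.
have [N _ /(_ N (leqnn N)) HN] : \forall n \near \oo, (mu (A n) < (2^-1)%:E)%E.
  have /fine_cvgP[_ cvf] := cvA.
  have h2 : 0 < 2^-1 :> R by rewrite invr_gt0.
  have := cvgr_lt 0 cvf (2^-1) => /(_ _ h2).
  by apply: filterS => n /=; rewrite -lte_fin fineK//; exact: fin_num_measure.
exists N.+1%:R^-1; first by rewrite invr_gt0.
by apply: oscillates_null => //; exact: cvg_rsum_incr.
Qed.

(** Control of increments becomes control of values by anchoring at one point of C, where the series
    converges: e/2 for the increment and twice e/4 at the anchor. *)
Let cauchy_on x (C : set rat) e N : 0 < e -> regular_limit (rsum g x) ->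
  (forall q, C q -> 0 <= q <= 1) ->
  (forall p q n k, C p -> C q -> (N <= n)%N -> (N <= k)%N ->
    `|rsum incr x n (p, q) - rsum incr x k (p, q)| <= e / 2) ->
  exists N, forall n k, (N <= n)%N -> (N <= k)%N -> forall q, C q ->
    `|rsum g x n q - rsum g x k q| <= e.
Proof.
move=> e0 [cg _] C01 HN.
have [[p Cp]|noC] := pselect (exists p, C p); last first.
  by exists 0%N => n k _ _ q Cq; exfalso; apply: noC; exists q.
have e4 : 0 < e / 4 by lra.
have /cvgrPdist_le /(_ _ e4)[M _ HM] := cg _ (C01 _ Cp).
exists (maxn N M) => n k; rewrite !geq_max => /andP[Nn Mn] /andP[Nk Mk] q Cq.
have := HM _ Mn; have := HM _ Mk; have := HN _ _ _ _ Cp Cq Nn Nk.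
rewrite !rsum_incr /=; set l := lim _.
rewrite !ler_norml => /andP[? ?] /andP[? ?] /andP[? ?].
by apply/andP; split; lra.
Qed.

Lemma rademacher_uniformly_cauchy :
  {ae mu, forall x, uniformly_cauchy (rsum g x)}.
Proof.
apply: ae_foralln => m.
have e0 : 0 < m.+1%:R^-1 :> R by rewrite invr_gt0.
move: (m.+1%:R^-1) e0 => e e0.
(* The almost sure quantifier is inside [Q]: gluing two intervals unites two null sets, and Cousin's
   lemma needs no more. *)
pose Q (a b : R) := {ae mu, forall x, exists N, forall n k, (N <= n)%N ->
  (N <= k)%N -> forall q : rat, 0 <= q <= 1 -> a <= ratr q <= b ->
  `|rsum g x n q - rsum g x k q| <= e}.
have Q01 : Q 0 1; last first.
  apply: filterS Q01 => x [N HN]; exists N => n k Nn Nk q q01.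
  by apply: HN => //; rewrite ler0q -(rmorph1 (@ratr R)) ler_rat.
apply: cousin => [a b c _ _ _ _ Qab Qbc|t t01].
  apply: filterS2 Qab Qbc => x [N HN] [M HM]; exists (maxn N M) => n k.
  rewrite !geq_max => /andP[Nn Mn] /andP[Nk Mk] q q01 /andP[aq qc].
  have [qb|bq] := leP (ratr q) b; first by apply: HN; rewrite ?aq.
  by apply: HM; rewrite ?(ltW bq).
(* [oscillates_local] works at twice its argument, so e/4 yields the e/2 required by [cauchy_on]. *)
have e4 : 0 < e / 4 by lra.
have [d d0 osc0] := oscillates_local t e4.
exists d => // a b a0 ta at_ tb btd b1.
have nosc : {ae mu, forall x, ~ oscillates (near_pairs t d) incr (2 * (e / 4)) x}.
  exists (oscillates (near_pairs t d) incr (2 * (e / 4))); split => //.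
    exact: measurable_oscillates.
  by move=> x /= /contrapT.
apply: filterS2 g_regular nosc => x reg nx.
have [N HN] : exists N, forall n k i, (N <= n)%N -> (N <= k)%N ->
    near_pairs t d i -> `|rsum incr x n i - rsum incr x k i| <= e / 2.
  apply: contrapT => H; apply: nx => N; apply: contrapT => H'; apply: H.
  exists N => n k i Nn Nk Di; rewrite leNgt; apply/negP => ei; apply: H'.
  exists n, k; split => //; split => //; exists i; split => //.
  by rewrite (_ : 2 * (e / 4) = e / 2); [|field].
(* The left side, the right side and t itself are anchored separately, since the pairs controlled
   never straddle or touch t. *)
have [N1 H1] : exists N, forall n k, (N <= n)%N -> (N <= k)%N -> forall q : rat,
    0 <= q <= 1 /\ t - d < ratr q < t -> `|rsum g x n q - rsum g x k q| <= e.
  apply: (@cauchy_on x _ e N) => // [q []//|p q n k [p01 pt] [q01 qt] Nn Nk].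
  apply: HN => //; split => //=; first by nra.
    by rewrite ltr_norml; lra.
  by rewrite ltr_norml; lra.
have [N2 H2] : exists N, forall n k, (N <= n)%N -> (N <= k)%N -> forall q : rat,
    0 <= q <= 1 /\ t < ratr q < t + d -> `|rsum g x n q - rsum g x k q| <= e.
  apply: (@cauchy_on x _ e N) => // [q []//|p q n k [p01 pt] [q01 qt] Nn Nk].
  apply: HN => //; split => //=; first by nra.
    by rewrite ltr_norml; lra.
  by rewrite ltr_norml; lra.
have [N3 H3] : exists N, forall n k, (N <= n)%N -> (N <= k)%N -> forall q : rat,
    0 <= q <= 1 /\ ratr q = t -> `|rsum g x n q - rsum g x k q| <= e.
  apply: (@cauchy_on x _ e 0%N) => // [q []//|p q n k [p01 pt] [q01 qt] _ _].
  have -> : p = q by apply: (fmorph_inj (@ratr R)); exact: etrans pt (esym qt).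
  by rewrite !rsum_incr /= !subrr normr0; lra.
exists (maxn N1 (maxn N2 N3)) => n k.
rewrite !geq_max => /and3P[n1 n2 n3] /and3P[k1 k2 k3] q q01 qab.
have [qt|tq|qt] := ltgtP (ratr q) t.
- by apply: H1 => //; split => //; lra.
- by apply: H2 => //; split => //; lra.
- by apply: H3.
Qed.

End rademacher_cauchy.

(** * Nonvanishing of the LePage constant *)

Section gamma_constant.
Context {R : realType}.
Notation leb := (@lebesgue_measure R).

Let gamma_fun (x u : R) : R := u `^ (x - 1) * expR (- u).

Let one_powR (r : R) : 1 `^ r = 1.
Proof. by rewrite powR1. Qed.

Lemma measurable_gamma_fun x (D : set R) : measurable_fun D (gamma_fun x).
Proof.
apply: measurable_funTS; apply: measurable_funM; first exact: measurable_powR.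
by apply: measurableT_comp => //; exact: measurableT_comp.
Qed.

Let gamma_fun_ge0 x u : 0 <= gamma_fun x u.
Proof. by rewrite mulr_ge0 ?powR_ge0 ?expR_ge0. Qed.

Lemma powR_dyadic_le (r u : R) k : 0 <= r -> 0 < u -> (2 ^+ k)^-1 <= u ->
  u `^ (- r) <= (2 `^ r) ^+ k.
Proof.
move=> r0 u0 ku; have k0 : 0 < 2 ^+ k :> R by rewrite exprn_gt0.
rewrite powRN -powR_mulrn ?powR_ge0// -powRrM mulrC powRrM powR_mulrn//.
have uge0 := ltW u0; have kge0 := ltW k0.
rewrite -[leLHS]mul1r ler_pdivrMr ?powR_gt0// -powRM//.
rewrite -[leLHS](one_powR r); apply: ge0_ler_powR => //.
- by rewrite nnegrE.
- by rewrite nnegrE mulr_ge0.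
- by rewrite -ler_pdivrMl// mulr1.
Qed.

(* On ]2^-(k+1), 2^-k] the integrand is at most (2^(1-x))^(k+1), so the integral
   over ]0, 1] is dominated by a geometric series of ratio 2^-x. *)
Lemma gamma_integral_lty x : 0 < x < 1 ->
  (\int[leb]_(u in `]0%R, +oo[) (gamma_fun x u)%:E < +oo)%E.
Proof.
move=> x01; pose a : R := 2 `^ (1 - x).
have a0 : 0 < a by rewrite powR_gt0.
have a2 : a / 2 < 1.
  rewrite ltr_pdivrMr// mul1r /a powRD; last by rewrite pnatr_eq0 implybT.
  rewrite powRr1// gtr_pMr// powRN invf_lt1 ?powR_gt0//.
  rewrite -[ltLHS](powRr0 2) /powR pnatr_eq0 /= ltr_expR mul0r mulr_gt0//.
    by case/andP: x01.
  by rewrite ln_gt0// ltr1n.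
pose g k (u : R) := (a ^+ k.+1 * \1_(`]0, (2 ^+ k)^-1]%classic : set R) u)%:E.
pose e u := (exponential_pdf 1 u)%:E : \bar R.
have mD : measurable (`]0%R, +oo[%classic : set R) by [].
have mg k D : measurable_fun D (g k).
  by apply/measurable_EFinP; apply: measurable_funM.
have g0 k u : (0 <= g k u)%E.
  by rewrite lee_fin mulr_ge0// exprn_ge0// ltW.
have me D : measurable_fun D e.
  by apply/measurable_EFinP/measurable_funTS; exact: measurable_exponential_pdf.
have e0 u : (0 <= e u)%E by rewrite lee_fin exponential_pdf_ge0.
have msg D : measurable_fun D (fun u => \sum_(0 <= k <oo) g k u)%E.
  exact: ge0_emeasurable_sum.
have sg0 u : (0 <= \sum_(0 <= k <oo) g k u)%E by exact: nneseries_ge0.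
apply: (@le_lt_trans _ _ (\int[leb]_(u in `]0%R, +oo[)
    ((\sum_(0 <= k <oo) g k u) + e u))%E).
  apply: ge0_le_integral => //.
  - by move=> u _; rewrite lee_fin gamma_fun_ge0.
  - by apply/measurable_EFinP; exact: measurable_gamma_fun.
  - by apply: emeasurable_funD; [exact: msg|exact: me].
  move=> u; rewrite /= in_itv /= andbT => u0.
  have [u1|u1] := leP u 1; last first.
    apply: (le_trans _ (leeDr _ (sg0 u))); rewrite /e lee_fin exponential_pdfE ?(ltW u0)//.
    rewrite mul1r mulN1r ler_piMl ?expR_ge0//.
    rewrite -[X in u `^ X]opprB powRN invf_le1 ?powR_gt0//.
    rewrite -[leLHS](one_powR (1 - x)); apply: ge0_ler_powR; rewrite ?nnegrE ?ltW//.
    by rewrite subr_gt0; case/andP: x01.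
  have exk : exists k, (2 ^+ k.+1)^-1 <= u.
    have [k ku] := invrS_lt u0; exists k; apply: (le_trans _ (ltW ku)).
    rewrite lef_pV2 ?posrE ?exprn_gt0// -natrX ler_nat.
    by rewrite ltnW// ltn_expl.
  case: (ex_minnP exk) => k ku mink.
  have uk : u <= (2 ^+ k)^-1.
    case: k ku mink => [|k] _ mink; first by rewrite expr0 invr1.
    by rewrite leNgt; apply/negP => /ltW /mink; rewrite ltnn.
  apply: (le_trans _ (leeDl _ (e0 u))); apply: (@le_trans _ _ (g k u)).
    rewrite lee_fin indicE mem_set ?mulr1; last by rewrite /= in_itv /= u0.
    rewrite -[leRHS]mulr1 ler_pM ?powR_ge0 ?expR_ge0//; last first.
      by rewrite -expR0 ler_expR oppr_le0 ltW.
    rewrite -[X in u `^ X]opprB; apply: powR_dyadic_le => //.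
    by rewrite subr_ge0 ltW//; case/andP: x01.
  have := @nneseries_lim_ge R (g ^~ u) xpredT 0 k.+1 (fun n _ _ => g0 n u).
  by apply: le_trans; rewrite big_nat_recr//= leeDr// sume_ge0.
rewrite ge0_integralD//; [|exact: msg|exact: me].
apply: lte_add_pinfty; last first.
  apply: (@le_lt_trans _ _ (\int[leb]_u e u)%E).
    by apply: ge0_subset_integral => //; exact: me.
  by rewrite integral_exponential_pdf// ltry.
rewrite integral_nneseries//; last by move=> k; exact: mg.
apply: (@le_lt_trans _ _ (\sum_(0 <= k <oo) (geometric a (a / 2) k)%:E)%E).
  apply: lee_nneseries => [k _ _|k _].
    by apply: integral_ge0.
  under eq_integral do rewrite /g EFinM.
  rewrite ge0_integralZl_EFin//; first last.
  - by rewrite exprn_ge0// ltW.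
  - by apply/measurable_EFinP; exact: measurable_indic.
  rewrite integral_indic// setIidl; last first.
    by move=> u; rewrite /= !in_itv /= andbT => /andP[].
  rewrite [X in (_ * X <= _)%E](_ : _ = ((2 ^+ k)^-1)%:E); last first.
    by rewrite [LHS]lebesgue_measure_itv /= lte_fin invr_gt0 exprn_gt0// sube0.
  by rewrite -EFinM lee_fin /= exprS exprMn exprVn mulrA.
have na2 : `|a / 2| < 1 by rewrite ger0_norm// divr_ge0// ltW.
rewrite [X in (X < _)%E](_ : _ = (a / (1 - a / 2))%:E) ?ltry//.
apply/cvg_lim => //; apply: cvg_EFin.
  by apply: nearW => n; rewrite sumEFin.
under eq_fun do rewrite sumEFin /=.
have := cvg_geometric_series (a := a) na2.
by apply: cvg_trans; apply: near_eq_cvg; apply: nearW => n.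
Qed.

(** [fine] maps an infinite integral to 0, so finiteness is needed along with the lower bound of the
    integrand by exp(-1) on ]0, 1]. *)
Lemma euler_integral_gt0 (x : R) : 0 < x < 1 -> 0 < euler_integral x.
Proof.
move=> x01; apply: fine_gt0; rewrite (gamma_integral_lty x01) andbT.
have m01 : measurable (`]0, 1]%classic : set R) by [].
apply: (@lt_le_trans _ _ (\int[leb]_(u in `]0%R, 1%R]) (cst (expR (-1))%:E u))%E).
  rewrite integral_cst// [X in (_ < _ * X)%E](_ : _ = 1%E); last first.
    by rewrite [LHS]lebesgue_measure_itv /= lte_fin ltr01 sube0.
  rewrite mule1.
  by rewrite lte_fin expR_gt0.
apply: (@le_trans _ _ (\int[leb]_(u in `]0%R, 1%R]) (gamma_fun x u)%:E)%E).
  apply: ge0_le_integral => //.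
  - by move=> u _; rewrite lee_fin expR_ge0.
  - by apply/measurable_EFinP; exact: measurable_gamma_fun.
  move=> u; rewrite /= in_itv /= => /andP[u0 u1].
  rewrite lee_fin -[leLHS]mul1r ler_pM ?expR_ge0 ?ler_expR ?lerN2//.
  rewrite -[X in u `^ X]opprB powRN invf_ge1 ?powR_gt0//.
  rewrite -[leRHS](one_powR (1 - x)); apply: ge0_ler_powR; rewrite ?nnegrE//.
    by rewrite subr_ge0 ltW//; case/andP: x01.
  exact: ltW.
apply: (@ge0_subset_integral _ _ _ leb) => //.
- by apply/measurable_EFinP; exact: measurable_gamma_fun.
- by move=> u _; rewrite lee_fin.
- by move=> u; rewrite /= !in_itv /= andbT => /andP[].
Qed.

(** The shift in [Gamma] is 1 for alpha below 1 and 2 above, so Euler's integral is always evaluated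
    in ]0, 1[. *)
Lemma Gamma_neq0 (alpha : R) : 0 < alpha < 2 -> alpha != 1 ->
  Gamma (- alpha) != 0.
Proof.
move=> /andP[a0 a2] a1; rewrite /Gamma normrN gtr0_norm//.
have [aS|aS] := ltP alpha 1.
  rewrite (_ : Num.truncn alpha = 0%N); last by apply: truncn_def; rewrite ltW.
  apply: mulf_neq0; first by rewrite gt_eqF// euler_integral_gt0//; lra.
  by rewrite invr_eq0 big_ord_recl big_ord0 addr0 mulr1 oppr_eq0 gt_eqF.
have {}aS : 1 < alpha by rewrite lt_neqAle eq_sym a1.
rewrite (_ : Num.truncn alpha = 1%N); last by apply: truncn_def; rewrite ltW.
apply: mulf_neq0; first by rewrite gt_eqF// euler_integral_gt0//; lra.
rewrite invr_eq0 !big_ord_recl big_ord0 addr0 mulr1 mulf_neq0//.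
  by rewrite oppr_eq0 gt_eqF.
by rewrite addrC subr_eq0 eq_sym.
Qed.

Lemma c_neq0 (alpha : R) : 0 < alpha < 2 -> c_ alpha != 0.
Proof.
move=> a02; rewrite /c_; have [_|a1] := eqVneq alpha 1.
  by rewrite mulf_neq0// invr_neq0// gt_eqF// pi_gt0.
(* A real power of a nonzero base is an exponential, so it suffices that no factor of the base
   vanishes. *)
rewrite powR_eq0 negb_and mulf_neq0// ?Gamma_neq0//.
case/andP: a02 => a0 a2; rewrite mulf_neq0//; first by rewrite oppr_eq0 gt_eqF.
have [aS|aS] := ltP alpha 1.
  rewrite gt_eqF// cos_gt0_pihalf//.
  have := @pi_gt0 R; move: (pi : R) => p p0; nra.
have {}aS : 1 < alpha by rewrite lt_neqAle eq_sym a1.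
(* For alpha above 1 the angle lies in ]pi/2, pi[; shifting by pi brings it to where the cosine is
   positive. *)
have -> : pi * alpha / 2 = (pi * alpha / 2 - pi) + pi :> R by ring.
rewrite cosDpi oppr_eq0 gt_eqF// cos_gt0_pihalf//.
have := @pi_gt0 R; move: (pi : R) => p p0; nra.
Qed.

End gamma_constant.

(** * Conditioning on one of two independent variables *)

Section conditioning.
Context {d d1 d2} {T : measurableType d} {Z1 : measurableType d1}
  {Z2 : measurableType d2} {R : realType} (P : probability T R).
Variables (phi1 : {mfun T >-> Z1}) (phi2 : {mfun T >-> Z2}).
Hypothesis indep12 : forall A B, measurable A -> measurable B ->
  P (phi1 @^-1` A `&` phi2 @^-1` B) = (P (phi1 @^-1` A) * P (phi2 @^-1` B))%E.

Definition pair_rv (w : T) : Z1 * Z2 := (phi1 w, phi2 w).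

Let measurable_pair_rv : measurable_fun setT pair_rv.
Proof. exact: measurable_fun_pair. Qed.

HB.instance Definition _ :=
  @isMeasurableFun.Build _ _ T (Z1 * Z2)%type pair_rv measurable_pair_rv.

(** By independence the joint law is the product of the marginals, and by Fubini the exceptional set
    is null exactly when almost all its sections are. Both directions are used: one to freeze the
    first variable, the other to return. *)
Lemma ae_conditional (Q : Z1 -> Z2 -> Prop) :
  measurable [set z | Q z.1 z.2] ->
  {ae P, forall w, Q (phi1 w) (phi2 w)} <->
  {ae P, forall w, {ae distribution P phi2, forall y, Q (phi1 w) y}}.
Proof.
move=> mQ; pose B := ~` [set z | Q z.1 z.2].
have mB : measurable B by exact: measurableC.
pose law2 := distribution P phi2; pose h z := law2 (xsection B z).
have PB : P (pair_rv @^-1` B) = (\int[distribution P phi1]_z h z)%E.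
  apply/esym/(@product_measure_unique _ _ _ _ _ (distribution P phi1)
    (distribution P phi2) (distribution P pair_rv)) => //.
have mh : measurable_fun setT h by exact: measurable_fun_xsection.
have h0 z : (0 <= h z)%E by exact: measure_ge0.
have mh0 : measurable (h @^-1` [set 0%E]).
  by rewrite -[X in measurable X]setTI; exact: mh.
have sectionE z : h z = 0%E <-> {ae law2, forall y, Q z y}.
  apply: (iff_trans (iff_sym (negligibleP law2 (measurable_xsection z mB)))).
  have -> // : xsection B z = ~` [set y | Q z y].
  by apply/seteqP; split=> y; rewrite /xsection /= inE.
have E1 : {ae P, forall w, Q (phi1 w) (phi2 w)} <-> P (pair_rv @^-1` B) = 0%E.
  apply: (@negligibleP _ _ _ P (pair_rv @^-1` B)).
  by rewrite -[X in measurable X]setTI; exact: measurable_pair_rv.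
have E2 : (\int[distribution P phi1]_z h z)%E = 0%E <->
    {ae distribution P phi1, forall z, h z = 0%E}.
  have := ae_eq_integral_abs (distribution P phi1) measurableT mh.
  under eq_integral do rewrite gee0_abs//.
  move=> E; apply: (iff_trans E); split; apply: filterS => z //=.
  by apply.
have E3 : {ae distribution P phi1, forall z, h z = 0%E} <->
    {ae P, forall w, h (phi1 w) = 0%E}.
  have mC := measurableC mh0.
  have mC1 : measurable (phi1 @^-1` (~` (h @^-1` [set 0%E]))).
    by rewrite -[X in measurable X]setTI; exact: (measurable_funPT phi1).
  apply: (iff_trans (negligibleP (distribution P phi1) mC)).
  exact: (iff_sym (negligibleP P mC1)).
apply: (iff_trans E1); rewrite PB; apply: (iff_trans E2); apply: (iff_trans E3).
by split; apply: filterS => w /sectionE.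
Qed.

End conditioning.

(** * Measurability of convergence and of regular limits *)

Section measurable_limits.
Context {d} {Z : measurableType d} {R : realType}.

(** Completeness removes the unknown limit and leaves countable quantifiers. *)
Lemma cvgn_cauchyP (v : nat -> R) : cvgn v <->
  forall m : nat, exists N : nat, forall n k, (N <= n)%N -> (N <= k)%N ->
    `|v n - v k| <= m.+1%:R^-1.
Proof.
split=> [cv m|H].
  have e0 : 0 < m.+1%:R^-1 / 2 :> R by rewrite divr_gt0// invr_gt0.
  have /cvgrPdist_le /(_ _ e0)[N _ HN] := cv.
  exists N => n k /HN /= Hn /HN /= Hk.
  have -> : v n - v k = (lim (v @ \oo) - v k) - (lim (v @ \oo) - v n) by ring.
  by rewrite (le_trans (ler_normB _ _))// [leRHS]splitr lerD.
apply/cauchy_cvgP/cauchyP => e e0; have [m me] := invrS_lt e0.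
have [N HN] := H m; exists (v N); exists N => // n Nn /=.
by apply: le_lt_trans me; apply: HN.
Qed.

Lemma measurable_cvg_to0 (u : Z -> nat -> R) :
  (forall n, measurable_fun setT (u ^~ n)) ->
  measurable [set z | u z n @[n --> \oo] --> (0 : R)].
Proof.
move=> mu; rewrite (_ : [set _ | _] = [set z | forall m : nat,
    [set z | \forall n \near \oo, [set z | `|u z n| <= m.+1%:R^-1] z] z]).
  apply: measurable_forall => m; apply: measurable_near => n.
  by apply: measurable_le; exact: measurable_norm.
apply/seteqP; split=> z.
  move=> /cvgr0Pnorm_le uz m /=; apply: uz; by rewrite invr_gt0.
move=> H; apply/cvgr0Pnorm_le => e e0; have [m me] := invrS_lt e0.
by apply: filterS (H m) => n un; apply: le_trans un _; exact: ltW.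
Qed.

Variable u : Z -> nat -> rat -> R.
Hypothesis mu : forall n q, measurable_fun setT (fun z => u z n q).

Let measurable_diff_le n k q e : measurable [set z | `|u z n q - u z k q| <= e].
Proof. by apply: measurable_le; apply: measurable_norm; exact: measurable_funB. Qed.

Lemma measurable_uniformly_cauchy : measurable [set z | uniformly_cauchy (u z)].
Proof.
apply: measurable_forall => m; apply: measurable_exists => N.
apply: measurable_forall => n; apply: measurable_forall => k.
apply: measurable_imply => _; apply: measurable_imply => _.
apply: measurable_forall => q; apply: measurable_imply => _.
exact: measurable_diff_le.
Qed.

Let measurable_osc_chain n e l : measurable [set z | osc_chain (u z n) e l].
Proof.
rewrite /osc_chain; set pw := pairwise _ l; case: pw; last first.
  by rewrite (_ : [set _ | _] = set0)//; apply/seteqP; split=> z //=; rewrite andbF.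
rewrite (_ : [set _ | _] = [set z | all (fun a => [&& 0 <= a.1, a.1 < a.2,
  a.2 <= 1 & e < `|u z n a.1 - u z n a.2|]) l]); last first.
  by apply/seteqP; split=> z /=; rewrite andbT.
elim: l => [|a l IH] /=; first by rewrite (_ : [set _ | _] = setT)//; apply/seteqP.
rewrite (_ : [set _ | _] = [set z | [&& 0 <= a.1, a.1 < a.2 & a.2 <= 1] /\
  [set z | e < `|u z n a.1 - u z n a.2|] z] `&` [set z | all (fun a => [&& 0 <= a.1, a.1 < a.2,
  a.2 <= 1 & e < `|u z n a.1 - u z n a.2|]) l]).
  apply: measurableI => //; apply: measurable_and => _.
  by apply: measurable_gt; apply: measurable_norm; exact: measurable_funB.
apply/seteqP; split=> z /=.
  by move=> /andP[/and4P[-> -> -> ->] ->].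
by move=> [[/and3P[-> -> ->] ->] ->].
Qed.

Lemma measurable_regular_limit : measurable [set z | regular_limit (u z)].
Proof.
apply: measurableI.
  apply: measurable_forall => q; apply: measurable_imply => _.
  rewrite [X in measurable X](_ : _ = [set z | forall m : nat, exists N : nat, forall n k,
      (N <= n)%N -> (N <= k)%N -> `|u z n q - u z k q| <= m.+1%:R^-1]); last first.
    by apply/seteqP; split=> z /cvgn_cauchyP.
  apply: measurable_forall => m; apply: measurable_exists => N.
  apply: measurable_forall => n; apply: measurable_forall => k.
  apply: measurable_imply => _; apply: measurable_imply => _.
  exact: measurable_diff_le.
apply: measurable_forall => m; apply: measurable_exists => K.
apply: measurable_forall => l; apply: measurable_imply => _.
by apply: measurableC; apply: measurable_near => n; exact: measurable_osc_chain.
Qed.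

End measurable_limits.

(** * Sigma-algebras generated by sequences *)

Section generated_sigma_algebras.
Context {d d'} {T : measurableType d} {T' : measurableType d'}.

Lemma sigma_of_seq_measurable (Y : nat -> T -> T') :
  (forall j, measurable_fun setT (Y j)) -> sigma_of_seq Y `<=` measurable.
Proof.
move=> mY; apply: smallest_sub; first exact: sigma_algebra_measurable.
by move=> _ [j _ [B mB <-]]; exact: mY.
Qed.

Lemma setI_closed_sigma_of_seq (Y : nat -> T -> T') : setI_closed (sigma_of_seq Y).
Proof.
move=> A B; exact: (@measurableI _ (g_sigma_algebraType (\bigcup_j sigma_of (Y j)))).
Qed.

Lemma sigma_of_seq_preimage (Y : nat -> T -> T') j B : measurable B ->
  sigma_of_seq Y (Y j @^-1` B).
Proof.
by move=> mB; apply: sub_sigma_algebra; exists j => //; exists B; rewrite ?setTI.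
Qed.

Lemma sigma_of_seqT (Y : nat -> T -> T') : sigma_of_seq Y setT.
Proof. by rewrite -(preimage_setT (Y 0%N)); exact: sigma_of_seq_preimage. Qed.

End generated_sigma_algebras.

(** * The signs as fair coins independent of the shocks *)

Section lepage_conditioning.
Context {d d'} {T : measurableType d} {S : measurableType d'} {R : realType}.
Context {P : probability T R} {m : {finite_measure set S -> \bar R}}.
Variables (V : nat -> {RV P >-> S}) (tau eps : nat -> {RV P >-> R}).
Hypothesis lepage_seq : lepage_sequences m V tau eps.

Lemma measurable_arrival j : measurable_fun setT (arrival tau j).
Proof. by apply: measurable_sum => i. Qed.

(* T with the sigma-algebra generated by all the V j and all the arrival
   times: conditioning on these leaves only the signs random. *)
Definition shock_sets : set_system T :=
  [set A `&` B | A in sigma_of_seq V & B in sigma_of_seq (arrival tau)].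

Definition shocks := g_sigma_algebraType shock_sets.

Lemma shock_sets_measurable : shock_sets `<=` measurable.
Proof.
move=> _ [A VA [B aB <-]]; apply: measurableI.
  by apply: sigma_of_seq_measurable VA.
by apply: sigma_of_seq_measurable aB; exact: measurable_arrival.
Qed.

(** The identity viewed as a random variable with values in the coarser space. *)
Definition to_shocks (w : T) : shocks := w.

Let measurable_to_shocks : measurable_fun setT to_shocks.
Proof.
apply: (@measurability _ _ T shocks setT to_shocks shock_sets) => //.
by move=> _ [A sA <-]; rewrite setTI; exact: shock_sets_measurable.
Qed.

HB.instance Definition _ :=
  @isMeasurableFun.Build _ _ T shocks to_shocks measurable_to_shocks.

Lemma measurable_shocks_V j : measurable_fun setT (V j : shocks -> S).
Proof.
move=> _ B mB; rewrite setTI; apply: sub_sigma_algebra.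
exists (V j @^-1` B); first exact: (sigma_of_seq_preimage (Y := fun j => V j)).
by exists setT; [exact: sigma_of_seqT | rewrite setIT].
Qed.

Lemma measurable_shocks_arrival j :
  measurable_fun setT (arrival tau j : shocks -> R).
Proof.
move=> _ B mB; rewrite setTI; apply: sub_sigma_algebra.
exists setT; first exact: sigma_of_seqT.
by exists (arrival tau j @^-1` B); [exact: sigma_of_seq_preimage | rewrite setTI].
Qed.

(** Defined for every w, also on the null set where some [eps j] is neither 1 nor -1. *)
Definition coin_of (w : T) : coins := fun j => 0 < eps j w.

Lemma coin_of_cyl s : coin_of @^-1` cyl s = [set w | forall i : nat,
  (i < size s)%N -> (0 < eps i w) = nth false s i].
Proof. by []. Qed.

Let coin_set (c : bool) : set R :=
  if c then `]0, +oo[%classic else `]-oo, 0]%classic.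

Let coin_setE c j w : (coin_set c (eps j w)) = ((0 < eps j w) = c).
Proof.
apply/propext; case: c; rewrite /coin_set /= in_itv /= ?andbT//.
by rewrite leNgt; split=> [/negbTE|->].
Qed.

(** Membership in the sigma-algebra generated by [eps], and not just measurability, is what the
    independence hypothesis accepts. *)
Lemma sigma_of_seq_coin_of C : measurable C ->
  sigma_of_seq eps (coin_of @^-1` C).
Proof.
pose TE := g_sigma_algebraType (\bigcup_j sigma_of (eps j)).
suff mc : measurable_fun setT (coin_of : TE -> coins).
  by move=> mC; have := mc measurableT _ mC; rewrite setTI.
apply: (@measurability _ _ TE coins setT coin_of cylinders) => //.
move=> _ [_ [->|[s ->]] <-]; first by rewrite preimage_set0 setI0.
rewrite setTI coin_of_cyl; apply: (@measurable_forall _ TE) => i.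
apply: (@measurable_imply _ TE) => _; apply: sub_sigma_algebra.
exists i => //; exists (coin_set (nth false s i)).
  by rewrite /coin_set; case: ifP.
by rewrite setTI; apply/seteqP; split=> w /=; rewrite coin_setE.
Qed.

Let measurable_coin_of : measurable_fun setT coin_of.
Proof.
move=> _ C mC; rewrite setTI.
by apply: sigma_of_seq_measurable (sigma_of_seq_coin_of mC).
Qed.

HB.instance Definition _ :=
  @isMeasurableFun.Build _ _ T coins coin_of measurable_coin_of.

(** For a fixed coin event, both sides are finite measures in A. They agree on [shock_sets], which
    is closed under intersection and generates, by the independence of the three sequences. *)
Lemma shocks_coin_indep (A : set shocks) (C : set coins) :
  measurable A -> measurable C ->
  P (to_shocks @^-1` A `&` coin_of @^-1` C) =
  (P (to_shocks @^-1` A) * P (coin_of @^-1` C))%E.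
Proof.
move=> mA mC; set D := coin_of @^-1` C.
have mD : measurable D by rewrite -[X in measurable X]setTI; exact: measurable_coin_of.
have fD : P D \is a fin_num by exact: fin_num_measure.
have D0 : 0 <= fine (P D) by exact: fine_ge0.
pose m1_ : {measure set shocks -> \bar R} := pushforward (mrestr P mD) to_shocks.
pose m1 := m1_ measurable_to_shocks.
pose m2 : {measure set shocks -> \bar R} :=
  mscale (NngNum D0) (distribution P to_shocks).
suff E : m1 A = m2 A.
  transitivity (m1 A) => //; rewrite E.
  transitivity ((fine (P D))%:E * P (to_shocks @^-1` A))%E => //.
  by rewrite fineK// muleC.
apply: (@measure_unique _ R shocks shock_sets (fun _ => setT)) => //.
- move=> _ _ [A1 VA1 [B1 aB1 <-]] [A2 VA2 [B2 aB2 <-]].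
  exists (A1 `&` A2); first exact: setI_closed_sigma_of_seq.
  exists (B1 `&` B2); first exact: setI_closed_sigma_of_seq.
  by rewrite setIACA.
- move=> _; exists setT; first exact: sigma_of_seqT.
  by exists setT; [exact: sigma_of_seqT | rewrite setIT].
- by rewrite bigcup_const.
- move=> _ [A1 VA1 [B1 aB1 <-]].
  transitivity (P (A1 `&` B1 `&` D)) => //.
  transitivity ((fine (P D))%:E * P (A1 `&` B1))%E => //.
  have sD := sigma_of_seq_coin_of mC.
  have [_ _ _ _ _ _ ind] := lepage_seq.
  have sT : sigma_of_seq eps setT by exact: sigma_of_seqT.
  have := ind _ _ _ VA1 aB1 sT.
  rewrite setIT probability_setT mule1 => AB.
  by rewrite (ind _ _ _ VA1 aB1 sD) fineK// -AB muleC.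
- move=> _; change (P (setT `&` D) < +oo)%E.
  by rewrite setTI (le_lt_trans (probability_le1 P mD))// ltry.
Qed.

(** Each of the two complementary events has probability at least 1/2, hence exactly 1/2. *)
Let eps_half j c : P (eps j @^-1` coin_set c) = (2^-1)%:E.
Proof.
have [p1 pN1] := lepage_eps_law lepage_seq j.
have m1 c' : measurable (eps j @^-1` coin_set c').
  apply: measurable_funPTI; rewrite /coin_set; case: ifP => //.
have ge c' : ((2^-1)%:E <= P (eps j @^-1` coin_set c'))%E.
  case: c'; [rewrite -p1|rewrite -pN1];
    (apply: le_measure; rewrite ?inE; [exact: measurable_funPTI|exact: m1|]) =>
    w /= ->; by rewrite in_itv /= ?ltr01 ?lerN10.
have sum1 : (P (eps j @^-1` coin_set c) + P (eps j @^-1` coin_set (~~ c)) = 1)%E.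
  rewrite -measureU//; last first.
    by apply/seteqP; split=> // w [] /=; rewrite !coin_setE => ->; case: (c).
  rewrite -(@probability_setT _ _ _ P); congr (P _); apply/seteqP; split=> // w _.
  by rewrite /= !coin_setE; case: (0 < _); case: (c); [left|right|right|left].
apply/eqP; rewrite eq_le ge andbT.
have f c' : P (eps j @^-1` coin_set c') \is a fin_num by exact: fin_num_measure.
move: sum1 (ge (~~ c)); rewrite -(fineK (f c)) -(fineK (f (~~ c))) -EFinD.
by move=> [E]; rewrite !lee_fin => h; lra.
Qed.

Lemma fair_coin_of : fair (distribution P coin_of).
Proof.
move=> s; pose J := [fset i | i in iota 0 (size s)]%fset.
have -> : distribution P coin_of (cyl s) =
    P (\bigcap_(i in [set` J]) (eps i @^-1` coin_set (nth false s i))).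
  congr (P _); apply/seteqP; split=> w H i.
    by rewrite /= !inE /= mem_iota add0n => i_s; rewrite coin_setE; exact: H.
  by move=> i_s; have := H i; rewrite /= !inE /= mem_iota coin_setE; exact.
rewrite (lepage_eps_indep lepage_seq); last first.
  move=> i _; exists (coin_set (nth false s i)); last by rewrite setTI.
  by rewrite /coin_set; case: ifP.
rewrite (eq_bigr (fun _ => (2^-1)%:E)); last by move=> i _; exact: eps_half.
have -> : size s = size J.
  by rewrite card_fseq undup_id ?iota_uniq// size_iota.
elim: (J : seq nat) => [|i l IH]; first by rewrite big_nil expr0.
by rewrite big_cons IH -EFinM exprS.
Qed.

Lemma ae_eps_sg : {ae P, forall w j, eps j w = sg (coin_of w j)}.
Proof.
apply: ae_foralln => j; have [p1 pN1] := lepage_eps_law lepage_seq j.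
have m1 r : measurable (eps j @^-1` [set r]) by exact: measurable_funPTI.
pose A := eps j @^-1` [set 1] `|` eps j @^-1` [set -1].
have mA : measurable A by exact: measurableU.
have PA : P A = 1%E.
  have h2 : 2^-1 + 2^-1 = 1 :> R by lra.
  rewrite measureU; [|exact: m1|exact: m1|].
    apply: (etrans (congr2 adde p1 pN1)).
    exact: (congr1 (@EFin R) h2).
  apply/seteqP; split=> // w [] /= -> /eqP.
  by rewrite -subr_eq0 opprK -mulr2n pnatr_eq0.
exists (~` A); split; first exact: measurableC.
  by apply: (etrans (probability_setC P mA)); rewrite PA subee.
move=> w /= nw Aw; apply: nw; rewrite /coin_of /sg.
case: Aw => /= ->; first by rewrite ltr01.
by rewrite ltr0N1.
Qed.

End lepage_conditioning.

(** * Transfer lemmas for almost sure statements, uniform limits and signed series *)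

Lemma ae_countable {d} {T : measurableType d} {R : realType}
    (mu : {measure set T -> \bar R}) (U : Type) (D : set U) (Q : U -> T -> Prop) :
  countable D -> (forall t, D t -> {ae mu, forall w, Q t w}) ->
  {ae mu, forall w, forall t, D t -> Q t w}.
Proof.
move=> /countable_injP[h hinj] aeQ.
have : {ae mu, forall w, forall n t, D t -> h t = n -> Q t w}.
  apply: ae_foralln => n.
  have [[t [Dt ht]]|no] := pselect (exists t, D t /\ h t = n).
    apply: filterS (aeQ _ Dt) => w Qt t' Dt' ht'.
    by rewrite (hinj t' t) ?inE// ht'.
  by apply: aeW => w t Dt ht; exfalso; apply: no; exists t.
by apply: filterS => w Qw t Dt; exact: (Qw (h t)).
Qed.

Lemma cvg_uniform_on {R : realType} (A : set R) (y : nat -> R -> R) (x : R -> R) :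
  (forall e, 0 < e -> exists N : nat, forall n, (N <= n)%N ->
    forall t, A t -> `|y n t - x t| <= e) ->
  {uniform A, y @ \oo --> x}.
Proof.
move=> H U /uniform_nbhs[E [+ EU]]; rewrite -entourage_ballE => -[e /= e0 eE].
have e20 : 0 < e / 2 by lra.
have [N HN] := H _ e20; exists N => // n /= Nn; apply: EU => t At; apply: eE => /=.
by rewrite /ball /= distrC (le_lt_trans (HN _ Nn _ At))//; lra.
Qed.

(** Flipping coin j alone preserves the measure, so for some x the series tends to 0 both before and
    after the flip; the two sums differ by a constant of absolute value twice that of [h j]. *)
Lemma rademacher_coef_eq0 {R : realType} (mu : probability coins R)
    (h : nat -> R) : fair mu ->
  {ae mu, forall x, rsum (fun j (_ : unit) => h j) x n tt @[n --> \oo] --> (0 : R)} ->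
  forall j, h j = 0.
Proof.
move=> mu_fair H j; pose b i := i == j.
have Hb := ae_flip mu_fair b H.
have PF : ProperFilter (almost_everywhere mu).
  apply: ae_properfilter_algebraOfSetsType.
  by rewrite [X in (_ < X)%E](probability_setT mu) lte_fin ltr01.
have [x [xb xx]] := filter_ex (filterI Hb H).
pose D := rsum (fun j (_ : unit) => h j) x j.+1 tt
  - rsum (fun j (_ : unit) => h j) (flip b x) j.+1 tt.
have DE : D = 2 * (sg (x j) * h j).
  rewrite /D /rsum !big_ord_recr /= /flip /b eqxx addbT sgN.
  rewrite [X in _ - (X + _)](eq_bigr (fun i : 'I_j => sg (x i) * h i)).
    by ring.
  by move=> i _; rewrite ltn_eqF// addbF.
have : D = 0.
  have cv : rsum (fun j (_ : unit) => h j) x n tt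
      - rsum (fun j (_ : unit) => h j) (flip b x) n tt @[n --> \oo] --> (0 : R).
    by rewrite -[0]subr0; exact: cvgB.
  rewrite -(cvg_lim (@Rhausdorff R) cv); apply/esym/cvg_lim => //.
  apply: cvg_near_cst; exists j.+1 => // n /= jn.
  apply/eqP; rewrite -subr_eq0 /D; apply/eqP.
  have := @rsum_flip_head _ _ (fun j (_ : unit) => h j) b j.+1 n j.+1 x tt.
  move=> /(_ _ jn (leqnn _)) E.
  have {}E := E (fun i ji => gtn_eqF ji); lra.
rewrite DE => /eqP; rewrite mulf_eq0 pnatr_eq0 /= mulf_eq0 => /orP[|/eqP//].
by rewrite /sg; case: ifP => _; rewrite ?oppr_eq0 oner_eq0.
Qed.

(** * The LePage series: uniform convergence and jumps *)

Section lepage_series.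
Context {R : realType} {d d' : measure_display}
  {T : measurableType d} {S : measurableType d'}
  {P : probability T R} {m : {finite_measure set S -> \bar R}}.
Variables (alpha : R) (f : R -> S -> R) (X : R -> {RV P >-> R})
  (V : nat -> {RV P >-> S}) (tau eps : nat -> {RV P >-> R}).
Hypothesis alpha_range : 0 < alpha < 2.
Hypothesis measurable_f : forall t, 0 <= t <= 1 -> measurable_fun setT (f t).
Hypothesis lepage_seq : lepage_sequences m V tau eps.
Hypothesis X_lepage : forall t : R, 0 <= t <= 1 ->
  {ae P, forall w, lepage_sum m alpha V tau eps (f t) w n @[n --> \oo] --> X t w}.
Hypothesis X_cadlag : forall w, cadlag01 (fun t => X t w).
Hypothesis X_cont_prob : continuous_in_prob01 P X.
Hypothesis f_cadlag : forall s, cadlag01 (fun t => f t s).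

Let K : R := c_ alpha * fine (m setT) `^ alpha^-1.

Let coin := @coin_of _ _ _ P eps.

Let rat01 (q : rat) : 0 <= q <= 1 -> 0 <= (ratr q : R) <= 1.
Proof. by rewrite ler0q -(rmorph1 (@ratr R)) ler_rat. Qed.

(* The summands without their signs.  They vanish outside [0, 1], where
   f t need not be measurable. *)
Let shock (w : shocks V tau) (j : nat) (q : rat) : R :=
  K * (arrival tau j w `^ (- alpha^-1) *
    (if 0 <= q <= 1 then f (ratr q) (V j w) else 0)).

Let measurable_weight j : measurable_fun setT
  ((fun w => arrival tau j w `^ (- alpha^-1)) : shocks V tau -> R).
Proof.
apply: (@measurableT_comp _ _ _ _ _ _ (@powR R ^~ (- alpha^-1))).
  exact: measurable_powR.
exact: measurable_shocks_arrival.
Qed.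

Let measurable_shock j q : measurable_fun setT (fun w => shock w j q).
Proof.
apply: measurable_funM => //; apply: measurable_funM; first exact: measurable_weight.
have [q01|//] := boolP (0 <= q <= 1).
apply: (measurableT_comp (measurable_f (rat01 q01))).
exact: measurable_shocks_V.
Qed.

Let measurable_rsum_shock n q :
  measurable_fun setT (fun z : shocks V tau * coins => rsum (shock z.1) z.2 n q).
Proof.
apply: measurable_sum => j; apply: measurable_funM.
  exact: (measurableT_comp (measurable_sg_coin _)).
exact: (measurableT_comp (measurable_shock _ _)).
Qed.

Let lepage_sumE w t n : lepage_sum m alpha V tau eps (f t) w n =
  \sum_(j < n) (K * (eps j w * arrival tau j w `^ (- alpha^-1))) * f t (V j w).
Proof.
by rewrite /lepage_sum mulr_sumr; apply: eq_bigr => j _;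
  rewrite /lepage_term -/K !mulrA.
Qed.

Let rsum_lepage w n q : (forall j, eps j w = sg (coin w j)) -> 0 <= q <= 1 ->
  rsum (shock w) (coin w) n q = lepage_sum m alpha V tau eps (f (ratr q)) w n.
Proof.
move=> eps_sg q01; rewrite lepage_sumE; apply: eq_bigr => j _.
by rewrite /shock q01 eps_sg; ring.
Qed.

Let cvg_rat : {ae P, forall w (q : rat), 0 <= q <= 1 ->
  lepage_sum m alpha V tau eps (f (ratr q)) w n @[n --> \oo] --> X (ratr q) w}.
Proof.
apply: (ae_countable (D := [set q : rat | 0 <= q <= 1])) => //.
by move=> q q01; apply: X_lepage; exact: rat01.
Qed.

(** The paths of [X] enter here, and leave behind a property of shocks and coins alone. *)
Let rsum_regular : {ae P, forall w, regular_limit (rsum (shock w) (coin w))}.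
Proof.
apply: filterS2 cvg_rat (ae_eps_sg lepage_seq) => w cX eps_sg.
apply: cadlag_regular_limit (X_cadlag w) _ => q q01.
under eq_fun do rewrite rsum_lepage//.
exact: cX.
Qed.

(** With the shocks frozen the coefficients are deterministic and the coins fair, so the Rademacher
    result applies; conditioning is used once in each direction. *)
Let rsum_cauchy : {ae P, forall w, uniformly_cauchy (rsum (shock w) (coin w))}.
Proof.
have indep := shocks_coin_indep lepage_seq.
have mC := measurable_uniformly_cauchy measurable_rsum_shock.
have mL := measurable_regular_limit measurable_rsum_shock.
apply/(ae_conditional indep
  (Q := fun z x => uniformly_cauchy (rsum (shock z) x)) mC).
have /(ae_conditional indep
  (Q := fun z x => regular_limit (rsum (shock z) x)) mL) := rsum_regular.
apply: filterS => w; apply: rademacher_uniformly_cauchy.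
exact: (fair_coin_of lepage_seq).
Qed.

Let lepage_sum_cadlag w n : cadlag01 (fun t => lepage_sum m alpha V tau eps (f t) w n).
Proof.
under eq_fun do rewrite lepage_sumE.
apply: (@cadlag_sum _ (fun j => K * (eps j w * arrival tau j w `^ (- alpha^-1)))
  (fun j t => f t (V j w))) => j.
exact: f_cadlag.
Qed.

Lemma lepage_uniform : {ae P, forall w, forall e, 0 < e ->
  exists N : nat, forall n, (N <= n)%N -> forall t, 0 <= t <= 1 ->
    `|lepage_sum m alpha V tau eps (f t) w n - X t w| <= e}.
Proof.
have := ae_eps_sg lepage_seq; have := rsum_cauchy; apply: filterS3 cvg_rat.
move=> w cX uc eps_sg; apply: (uniformly_cauchy_cvg
  (y := fun n t => lepage_sum m alpha V tau eps (f t) w n)) => //.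
move=> k; have [N HN] := uc k; exists N => n l Nn Nl q q01.
by rewrite -!rsum_lepage//; exact: HN.
Qed.

Lemma lepage_jump : {ae P, forall w t, 0 <= t <= 1 ->
  lepage_sum m alpha V tau eps (fun s => jump (fun u => f u s) t) w n
    @[n --> \oo] --> jump (fun u => X u w) t}.
Proof.
apply: filterS lepage_uniform => w Hw t t01.
have := jump_cvg (X_cadlag w) (lepage_sum_cadlag w) Hw t01.
apply: cvg_trans; apply: near_eq_cvg; apply: nearW => n.
under eq_fun do rewrite lepage_sumE.
rewrite (@jump_sum _ (fun j => K * (eps j w * arrival tau j w `^ (- alpha^-1)))
  (fun j t => f t (V j w)))//.
by rewrite /lepage_sum mulr_sumr; apply: eq_bigr => j _;
  rewrite /lepage_term -/K !mulrA.
Qed.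

(** A jump larger than 1/(n+1) puts w in [A k] for all large k, hence in some [B N]. The latter is
    null, being contained in events [A k] whose probabilities tend to 0 by continuity in
    probability. *)
Lemma no_fixed_jump t : 0 <= t <= 1 ->
  {ae P, forall w, jump (fun u => X u w) t = 0}.
Proof.
move=> t01; have [t0|t0] := eqVneq t 0.
  by apply: aeW => w; rewrite /jump t0 eqxx.
have {}t01 : 0 < t <= 1 by rewrite lt0r t0.
have [v [v01 vcvg vjump]] := jump_seq t01.
have jE w := vjump _ (X_cadlag w).
have half n : {ae P, forall w, `|jump (fun u => X u w) t| <= n.+1%:R^-1}.
  have n0 : 0 < n.+1%:R^-1 :> R by rewrite invr_gt0.
  pose A k := [set w | n.+1%:R^-1 < `|X (v k) w - X t w|].
  have mA k : measurable (A k).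
    by apply: measurable_gt; apply: measurable_norm; exact: measurable_funB.
  have PA : P (A k) @[k --> \oo] --> 0%E.
    apply: cvg_comp (X_cont_prob (t := t) _ n0); last first.
      by case/andP: t01 => /ltW -> ->.
    move=> U [e /= e0 eU]; move/cvgrPdist_lt : vcvg => /(_ _ e0).
    by apply: filterS => k /= tv; apply: eU => //; rewrite /= in_itv /= v01.
  pose B N := [set w | forall k, [set w | (N <= k)%N -> A k w] w].
  have mB N : measurable (B N).
    by apply: measurable_forall => k; apply: measurable_imply => _.
  have PB N : P (B N) = 0%E.
    apply/eqP; rewrite -measure_le0.
    have le k : (N <= k)%N -> (P (B N) <= P (A k))%E.
      by move=> Nk; apply: le_measure; rewrite ?inE// => w Bw; exact: Bw.
    rewrite -(cvg_lim _ PA)//; apply: lime_ge.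
      by apply/cvg_ex; eexists; exact: PA.
    by exists N.
  apply: (negligibleS (A := \bigcup_N B N)).
    move=> w /= /negP; rewrite -ltNge => jn.
    have : \forall k \near \oo, n.+1%:R^-1 < `|X t w - X (v k) w|.
      by apply: (cvgr_gt _ (cvg_norm (jE w))).
    by move=> [N _ HN]; exists N => // k Nk; rewrite /A /= distrC; exact: HN.
  by apply: negligible_bigcup => N; apply/(negligibleP P (mB N)); exact: PB.
apply: filterS (ae_foralln half) => w Hw; apply/eqP; rewrite -normr_le0.
apply/ler_addgt0Pr => e e0; rewrite add0r; have [n ne] := invrS_lt e0.
exact: le_trans (Hw n) (ltW ne).
Qed.

Let K_neq0 : K != 0.
Proof.
have mS : fine (m setT) != 0.
  (* With m(S) = 0 the prescribed law of [V 0] would have total mass 0. *)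
  apply/eqP => m0; have := lepage_V_law lepage_seq 0 measurableT.
  by rewrite preimage_setT probability_setT m0 mul0r => -[] /eqP; rewrite oner_eq0.
by rewrite mulf_neq0 ?c_neq0// powR_eq0 negb_and mS.
Qed.

(** At a zero arrival time the power defining the weight takes the value 0, and a vanishing
    coefficient would then say nothing about the jump. *)
Let arrival_neq0 : {ae P, forall w j, arrival tau j w != 0}.
Proof.
have tau_gt0 : {ae P, forall w j, 0 < tau j w}.
  apply: ae_foralln => j; exists (tau j @^-1` `]-oo, 0]%classic); split.
  - exact: measurable_funPTI.
  - apply: (etrans (lepage_tau_law lepage_seq j _)) => //.
    rewrite /exponential_prob -integral_itv_bndo_bndc; last first.
      apply/measurable_EFinP/measurable_funTS.
      exact: measurable_exponential_pdf.
    apply: integral0_eq => x /=; rewrite in_itv /= => x0.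
    by rewrite lt0_exponential_pdf.
  - by move=> w /= /negP; rewrite in_itv /= -leNgt.
apply: filterS tau_gt0 => w tw j; rewrite gt_eqF// /arrival big_ord_recl.
by rewrite ltr_wpDr// sumr_ge0// => i _; exact: ltW.
Qed.

Let measurable_jump t : 0 <= t <= 1 ->
  measurable_fun setT (fun s => jump (fun u => f u s) t).
Proof.
move=> t01; have [->|t0] := eqVneq t 0.
  by rewrite (_ : (fun s => _) = cst 0)//; apply/funext => s; rewrite /jump eqxx.
have {}t01 : 0 < t <= 1 by rewrite lt0r t0.
have [v [v01 _ vjump]] := jump_seq t01.
apply: (measurable_fun_cvg (h := fun n s => f t s - f (v n) s)) => [n|s _].
  apply: measurable_funB; apply: measurable_f => //.
  by case/andP: t01 => /ltW -> ->.
exact: vjump (f_cadlag s).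
Qed.

(** The series of jumps at t converges to the jump of [X], which is 0. Given the shocks it is a
    Rademacher series with limit 0, so every coefficient vanishes, and the weights are nonzero. *)
Lemma shock_no_fixed_jump t : 0 <= t <= 1 ->
  {ae P, forall w j, jump (fun u => f u (V j w)) t = 0}.
Proof.
move=> t01; have indep := shocks_coin_indep lepage_seq.
pose h (w : shocks V tau) j : R :=
  arrival tau j w `^ (- alpha^-1) * jump (fun u => f u (V j w)) t.
have mh j : measurable_fun setT (fun w => h w j).
  apply: measurable_funM; first exact: measurable_weight.
  apply: (measurableT_comp (measurable_jump t01)).
  exact: measurable_shocks_V.
pose Q (w : shocks V tau) (x : coins) :=
  rsum (fun j (_ : unit) => h w j) x n tt @[n --> \oo] --> (0 : R).
have mQ : measurable [set z : shocks V tau * coins | Q z.1 z.2].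
  apply: (@measurable_cvg_to0 _ _ _ (fun z n => rsum (fun j (_ : unit) => h z.1 j) z.2 n tt)).
  move=> n; apply: measurable_sum => j; apply: measurable_funM.
    exact: (measurableT_comp (measurable_sg_coin _)).
  exact: (measurableT_comp (mh _)).
have aeQ : {ae P, forall w, Q w (coin w)}.
  have := ae_eps_sg lepage_seq; have := no_fixed_jump t01.
  apply: filterS3 lepage_jump => w jw j0 eps_sg.
  have := jw _ t01; rewrite j0 => cv.
  have : K^-1 * lepage_sum m alpha V tau eps (fun s => jump (fun u => f u s) t) w n
      @[n --> \oo] --> K^-1 * 0 by apply: cvgM => //; exact: cvg_cst.
  rewrite mulr0; apply: cvg_trans; apply: near_eq_cvg; apply: nearW => n.
  rewrite /lepage_sum mulrA (mulVf K_neq0) mul1r; apply: eq_bigr => j _.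
  by rewrite /lepage_term /h eps_sg mulrA.
have /(ae_conditional indep mQ) := aeQ.
have := arrival_neq0; apply: filterS2 => w a0 Qw j.
have : h w j = 0 by apply: rademacher_coef_eq0 Qw _; exact: (fair_coin_of lepage_seq).
move/eqP; rewrite mulf_eq0 powR_eq0 (negPf (a0 j)) /= => /eqP //.
Qed.

Let jump_apart (s s' : S) := forall t, 0 <= t <= 1 ->
  jump (fun u => f u s) t * jump (fun u => f u s') t = 0.

Let measurable_jump_apart : measurable [set z : S * S | jump_apart z.1 z.2].
Proof.
pose G (p q : rat) (k : nat) :=
  [/\ 0 <= ratr p :> R, ratr p < ratr q :> R & ratr q <= 1 :> R] /\
  ratr q - ratr p < k.+1%:R^-1 :> R.
pose F i (p q : rat) : set (S * S) :=
  [set z | i.+1%:R^-1 < `|f (ratr p) z.1 - f (ratr q) z.1|] `&`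
  [set z | i.+1%:R^-1 < `|f (ratr p) z.2 - f (ratr q) z.2|].
rewrite (_ : mkset _ = ~` [set z | exists i : nat, forall k : nat,
    exists p q : rat, G p q k /\ F i p q z]).
  apply: measurableC; apply: measurable_exists => i; apply: measurable_forall => k.
  apply: measurable_exists => p; apply: measurable_exists => q.
  apply: measurable_and => -[[p0 pq q1] _].
  have mp : measurable_fun setT (f (ratr p)).
    by apply: measurable_f; rewrite p0 (le_trans (ltW pq)).
  have mq : measurable_fun setT (f (ratr q)).
    by apply: measurable_f; rewrite q1 (le_trans p0 (ltW pq)).
  by apply: measurableI; apply: measurable_gt; apply: measurable_norm;
    apply: measurable_funB; apply: measurableT_comp.
apply/seteqP; split=> z; last first.
  move=> /= Hz t t01; apply/eqP/negPn/negP => jt; apply: Hz.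
  have [i Hm] := (common_jumpP (f_cadlag z.1) (f_cadlag z.2)).1
    (ex_intro _ t (conj t01 jt)).
  exists i => k; have [p [q [G1 [G2 F1 F2]]]] := Hm k.
  by exists p, q.
move=> /= apart [i Hm].
have [|t [t01 /eqP]] := (common_jumpP (f_cadlag z.1) (f_cadlag z.2)).2.
  exists i => k; have [p [q [[G1 G2] [F1 F2]]]] := Hm k.
  by exists p, q.
by apply; exact: apart.
Qed.

Let V_indep2 j k : j <> k -> forall A B, measurable A -> measurable B ->
  P (V j @^-1` A `&` V k @^-1` B) = (P (V j @^-1` A) * P (V k @^-1` B))%E.
Proof.
move=> jk A B mA mB; pose C i := V i @^-1` (if i == j then A else B).
have kj : (k == j) = false by apply/eqP => kj; exact: jk.
have := lepage_V_indep lepage_seq (J := [fset j; k]%fset) (A := C).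
rewrite big_fsetU1 /=; last by rewrite inE eq_sym kj.
rewrite big_seq_fset1 /C eqxx kj => <-.
  congr (P _); apply/seteqP; split=> w.
    by move=> [wj wk] i; rewrite /= !inE => /orP[] /eqP ->; rewrite ?eqxx ?kj.
  move=> H; split.
    by have := H j; rewrite /= !inE eqxx => /(_ isT).
  by have := H k; rewrite /= !inE kj eqxx orbT => /(_ isT).
move=> i _; exists (if i == j then A else B); first by case: ifP.
by rewrite setTI.
Qed.

(** With [V j] frozen, only its countably many jump times matter, and at each of them [V k] almost
    surely yields no jump. *)
Lemma jump_apart_ae j k : j <> k -> {ae P, forall w, jump_apart (V j w) (V k w)}.
Proof.
move=> jk; apply/(ae_conditional (V_indep2 jk) measurable_jump_apart).
apply: aeW => w; set s := V j w.
have jump0 t : 0 <= t <= 1 ->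
    {ae distribution P (V k), forall s', jump (fun u => f u s') t = 0}.
  move=> t01; have mJ := measurable_jump t01.
  pose A := ~` [set s' | jump (fun u => f u s') t = 0].
  have mA : measurable A.
    apply: measurableC; rewrite -[X in measurable X]setTI.
    by apply: (mJ measurableT [set 0]).
  apply/(negligibleP (distribution P (V k)) mA).
  have mVA : measurable (V k @^-1` A) by exact: measurable_funPTI.
  apply/(negligibleP P mVA).
  by apply: filterS (shock_no_fixed_jump t01) => w'; exact.
have H := ae_countable (mu := distribution P (V k))
  (Q := fun t s' => jump (fun u => f u s') t = 0) (countable_jumps (f_cadlag s)).
have : {ae distribution P (V k), forall s' t, 0 <= t <= 1 /\
    jump (fun u => f u s) t != 0 -> jump (fun u => f u s') t = 0}.
  by apply: H => t [t01 _]; exact: jump0.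
apply: filterS => s' Hs' t t01.
have [->|js] := eqVneq (jump (fun u => f u s) t) 0; first by rewrite mul0r.
by rewrite Hs' ?mulr0.
Qed.

Lemma jumps_apart :
  let E := [set w | forall (j k : nat) (t : R), j <> k -> 0 <= t <= 1 ->
    jump (fun u => f u (V j w)) t * jump (fun u => f u (V k w)) t = 0] in
  measurable E /\ P E = 1%E.
Proof.
move=> E; have mE : measurable E.
  (* The uncountable quantifier over t is absorbed in [jump_apart], already shown measurable on
     pairs; only countable ones remain. *)
  rewrite (_ : E = [set w | forall j k : nat, [set w | j <> k ->
      jump_apart (V j w) (V k w)] w]).
    apply: measurable_forall => j; apply: measurable_forall => k.
    apply: measurable_imply => _.
    have mVV : measurable_fun setT (fun w => (V j w, V k w)).
      exact: measurable_fun_pair.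
    have := mVV measurableT _ measurable_jump_apart.
    by rewrite setTI.
  by apply/seteqP; split=> w H j k t => [jk|/H]; [exact: H|exact].
split => //.
have E0 : P (~` E) = 0%E.
  apply/(negligibleP P (measurableC mE)).
  have : {ae P, forall w j k, j <> k -> jump_apart (V j w) (V k w)}.
    apply: ae_foralln => j; apply: ae_foralln => k.
    have [->|jk] := eqVneq j k; first by apply: aeW.
    by apply: filterS (jump_apart_ae (elimN eqP jk)).
  by apply: filterS => w Hw j k t jk; exact: Hw.
rewrite -[E]setCK [LHS](probability_setC P (measurableC mE)).
by rewrite [X in (_ - X)%E]E0 sube0.
Qed.

Lemma lepage_jump_unique : {ae P, forall w t, 0 <= t <= 1 -> forall j k,
  lepage_term alpha V tau eps (fun s => jump (fun u => f u s) t) w j != 0 ->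
  lepage_term alpha V tau eps (fun s => jump (fun u => f u s) t) w k != 0 ->
  j = k}.
Proof.
have [mE PE] := jumps_apart; set E := (X in measurable X) in mE PE.
have aeE : {ae P, forall w, E w}.
  apply/(negligibleP P (measurableC mE)).
  by rewrite [LHS](probability_setC P mE) PE subee.
apply: filterS aeE => w Ew t t01 j k.
rewrite /lepage_term !mulf_eq0 !negb_or => /andP[_ jj] /andP[_ jk].
apply: contrapT => njk; have /eqP := Ew _ _ _ njk t01.
by rewrite mulf_eq0 (negPf jj) (negPf jk).
Qed.

End lepage_series.

Theorem corollary4p1 (R : realType) (d d' : measure_display)
    (T : measurableType d) (S : measurableType d')
    (P : probability T R) (m : {finite_measure set S -> \bar R})
    (alpha : R) (f : R -> S -> R)
    (M : set S -> {RV P >-> R}) (X : R -> {RV P >-> R})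
    (V : nat -> {RV P >-> S}) (tau eps : nat -> {RV P >-> R})
    (alpha_range : 0 < alpha < 2)
    (M_sas : sas_random_measure m alpha M)
    (f_Lalpha : forall t : R, 0 <= t <= 1 -> f t \in Lfun m alpha%:E)
    (X_sas : sas_process01 P alpha X)
    (X_integral : forall t : R, 0 <= t <= 1 ->
      is_stable_integral m alpha M (f t) (X t))
    (lepage_seq : lepage_sequences m V tau eps)
    (X_lepage : forall t : R, 0 <= t <= 1 ->
      {ae P, forall w,
        lepage_sum m alpha V tau eps (f t) w n @[n --> \oo] --> X t w})
    (X_cadlag : forall w, cadlag01 (fun t => X t w))
    (X_cont_prob : continuous_in_prob01 P X)
    (f_cadlag : forall s, cadlag01 (fun t => f t s)) :
  let Df t s := jump (fun u => f u s) t in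
  [/\ {ae P, forall w,
        (forall t : R, 0 <= t <= 1 ->
          lepage_sum m alpha V tau eps (f t) w n @[n --> \oo] --> X t w) /\
        {uniform `[0, 1],
          (fun n t => lepage_sum m alpha V tau eps (f t) w n) @ \oo -->
          (fun t => X t w)}},
      {ae P, forall w (t : R), 0 <= t <= 1 ->
        lepage_sum m alpha V tau eps (Df t) w n @[n --> \oo] -->
          jump (fun u => X u w) t /\
        (forall j k,
          lepage_term alpha V tau eps (Df t) w j != 0 ->
          lepage_term alpha V tau eps (Df t) w k != 0 -> j = k)} &
      let E := [set w | forall (j k : nat) (t : R), j <> k -> 0 <= t <= 1 ->
                  Df t (V j w) * Df t (V k w) = 0] in
      measurable E /\ P E = 1%E].
Proof.
move=> Df.
(* Membership in L^alpha supplies the measurability of [f t]. *)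
have mf t : 0 <= t <= 1 -> measurable_fun setT (f t).
  by move=> /f_Lalpha/sub_Lfun_mfun; rewrite inE.
split.
- apply: filterS (lepage_uniform mf lepage_seq X_lepage X_cadlag f_cadlag) => w Hw.
  split; last exact: cvg_uniform_on.
  move=> t t01; apply/cvgrPdist_le => e e0; have [N HN] := Hw e e0.
  by exists N => // n /= Nn; rewrite distrC; exact: HN.
- have := lepage_jump_unique alpha_range mf lepage_seq X_lepage X_cadlag
    X_cont_prob f_cadlag.
  apply: filterS2 (lepage_jump mf lepage_seq X_lepage X_cadlag f_cadlag).
  move=> w Hj Hu t t01; split; first exact: Hj.
  exact: Hu t01.
- exact: jumps_apart alpha_range mf lepage_seq X_lepage X_cadlag X_cont_prob
    f_cadlag.
Qed.
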